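(* Let $n, k \in \mathbb{N}$. If $\mathbb{P}_n$ generates the same semigroup variety as $UT_k(\mathbb{T})$, then $k = n$.
   Context: $\mathbb{N} = \{1,2,\dots\}$. For an alphabet $\Sigma$, $\Sigma^+$ is the semigroup of all non-empty words over $\Sigma$ under concatenation. A semigroup identity ''$u=v$'' is a pair of distinct non-empty words over an alphabet $\Sigma$; a semigroup $S$ satisfies $u=v$ if every semigroup morphism $\Sigma^+ \to S$ maps $u$ and $v$ to the same element of $S$. The variety generated by a semigroup $S$ is the class of all semigroups that satisfy all semigroup identities satisfied by $S$. The plactic monoid of rank $n$, $\mathbb{P}_n$, is the monoid generated by $\{1,\dots,n\}$ subject to the Knuth relations: $bca = bac$ for $1 \le a < b \le c \le n$, and $cab = acb$ for $1 \le a \le b < c \le n$. The tropical semiring $\mathbb{T}$ is $\mathbb{R} \cup \{-\infty\}$ with semiring addition $x \oplus y = \max(x,y)$ and semiring multiplication given by ordinary addition $x + y$. $UT_k(\mathbb{T})$ is the semigroup, under tropical matrix multiplication, of all $k \times k$ matrices over $\mathbb{T}$ in which every entry below the diagonal is $-\infty$. *)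

(* Defs.v *)
From HB Require Import structures.
From mathcomp Require Import all_boot all_order all_algebra.
From mathcomp Require Import boolp reals.

Set Implicit Arguments.
Unset Strict Implicit.
Unset Printing Implicit Defensive.

Import Order.TTheory GRing.Theory Num.Theory.

Definition free_semigroup (X : choiceType) : Type := {w : seq X | ~~ nilp w}.

HB.instance Definition _ (X : choiceType) := Choice.on (free_semigroup X).

Section FreeSemigroup.
Variable X : choiceType.
Implicit Types u v w : free_semigroup X.

Fact concat_proof u v : ~~ nilp (val u ++ val v).
Proof. by case: u => -[|x u]. Qed.

Definition concat u v : free_semigroup X :=
  exist _ (val u ++ val v) (concat_proof u v).

Fact concatA : associative concat.
Proof. by move=> u v w; apply: val_inj; rewrite /= catA. Qed.

HB.instance Definition _ := isSemigroup.Build (free_semigroup X) concatA.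
End FreeSemigroup.

Definition satisfies (S : semigroupType) (X : choiceType)
    (u v : free_semigroup X) : Prop :=
  forall f : {multiplicative free_semigroup X -> S}, f u = f v.

(* The side condition [u != v] is there because a semigroup identity is by
   definition a pair of distinct words. *)
Definition in_variety (S T : semigroupType) : Prop :=
  forall (X : choiceType) (u v : free_semigroup X),
    u != v -> satisfies S u v -> satisfies T u v.

Definition same_variety (S1 S2 : semigroupType) : Prop :=
  forall T : semigroupType, in_variety S1 T <-> in_variety S2 T.

Section Presentation.
Variables (X : choiceType) (r : seq X -> seq X -> Prop).

Inductive congruence : seq X -> seq X -> Prop :=
| congr_rel u v : r u v -> congruence u v
| congr_refl u : congruence u u
| congr_sym u v : congruence u v -> congruence v u
| congr_trans u v w : congruence u v -> congruence v w -> congruence u w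
| congr_cat u u' v v' :
    congruence u u' -> congruence v v' -> congruence (u ++ v) (u' ++ v').

Definition congruenceb (u v : seq X) : bool := `[< congruence u v >].

Fact congruenceb_refl : reflexive congruenceb.
Proof. by move=> u; apply/asboolP/congr_refl. Qed.

Fact congruenceb_sym : symmetric congruenceb.
Proof. by move=> u v; apply/asboolP/asboolP; apply: congr_sym. Qed.

Fact congruenceb_trans : transitive congruenceb.
Proof.
by move=> v u w /asboolP uv /asboolP vw; apply/asboolP/(congr_trans uv vw).
Qed.

Canonical congruence_equiv_rel :=
  EquivRel congruenceb congruenceb_refl congruenceb_sym congruenceb_trans.

Local Open Scope quotient_scope.

Definition presented_monoid : Type := {eq_quot congruenceb}.

HB.instance Definition _ := Choice.on presented_monoid.
HB.instance Definition _ := EqQuotient.on presented_monoid.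

Definition presented_mul (x y : presented_monoid) : presented_monoid :=
  \pi_presented_monoid (repr x ++ repr y).

Lemma presented_eqP (u v : seq X) :
  \pi_presented_monoid u = \pi_presented_monoid v <-> congruence u v.
Proof.
have e := @eqmodP _ congruence_equiv_rel u v.
split; first by move=> uv; apply/asboolP/e.
by move=> uv; apply/e/asboolP.
Qed.

Lemma presented_mulE (u v : seq X) :
  presented_mul (\pi_presented_monoid u) (\pi_presented_monoid v) =
  \pi_presented_monoid (u ++ v).
Proof.
by apply/presented_eqP/congr_cat; apply/presented_eqP; rewrite reprK.
Qed.

Fact presented_mulA : associative presented_mul.
Proof.
move=> x y z; rewrite -[x]reprK -[y]reprK -[z]reprK.
rewrite (presented_mulE (repr y)) (presented_mulE (repr x)).
by rewrite (presented_mulE (repr x)) (presented_mulE (_ ++ _)) catA.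
Qed.

Fact presented_1mul : left_id (\pi_presented_monoid [::]) presented_mul.
Proof. by move=> x; rewrite -[x]reprK presented_mulE. Qed.

Fact presented_mul1 : right_id (\pi_presented_monoid [::]) presented_mul.
Proof. by move=> x; rewrite -[x]reprK presented_mulE cats0. Qed.

HB.instance Definition _ := isSemigroup.Build presented_monoid presented_mulA.
HB.instance Definition _ :=
  Magma_isUMagma.Build presented_monoid presented_1mul presented_mul1.
End Presentation.

(* The letters 1, ..., n are represented by the ordinals 0, ..., n - 1. *)
Inductive knuth (n : nat) : seq 'I_n -> seq 'I_n -> Prop :=
| knuth_bca (a b c : 'I_n) :
    (a < b)%N -> (b <= c)%N -> knuth [:: b; c; a] [:: b; a; c]
| knuth_cab (a b c : 'I_n) :
    (a <= b)%N -> (b < c)%N -> knuth [:: c; a; b] [:: a; c; b].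

Definition plactic (n : nat) : monoidType := presented_monoid (@knuth n).

(* [None] is -oo. *)
Definition tropical (R : realType) : Type := option R.

HB.instance Definition _ (R : realType) := Choice.on (tropical R).

Section Tropical.
Variable R : realType.
Implicit Types x y z : tropical R.
Local Open Scope ring_scope.

Definition trop_add x y : tropical R :=
  match x, y with
  | None, _ => y
  | _, None => x
  | Some a, Some b => Some (Num.max a b)
  end.

Definition trop_mul x y : tropical R :=
  match x, y with
  | Some a, Some b => Some (a + b)
  | _, _ => None
  end.

Fact trop_addA : associative trop_add.
Proof. by move=> [a|] [b|] [c|] //=; rewrite maxA. Qed.

Fact trop_addC : commutative trop_add.
Proof. by move=> [a|] [b|] //=; rewrite maxC. Qed.

Fact trop_add0 : left_id None trop_add.
Proof. by case. Qed.

Fact trop_mulA : associative trop_mul.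
Proof. by move=> [a|] [b|] [c|] //=; rewrite addrA. Qed.

Fact trop_mulC : commutative trop_mul.
Proof. by move=> [a|] [b|] //=; rewrite addrC. Qed.

Fact trop_mul1 : left_id (Some 0) trop_mul.
Proof. by case=> [a|] //=; rewrite add0r. Qed.

Fact trop_mulDl : left_distributive trop_mul trop_add.
Proof. by move=> [a|] [b|] [c|] //=; rewrite addr_maxl. Qed.

Fact trop_mul0 : left_zero None trop_mul.
Proof. by case. Qed.

Fact trop_1neq0 : Some 0 != None :> tropical R.
Proof. by []. Qed.

HB.instance Definition _ :=
  GRing.isNmodule.Build (tropical R) trop_addA trop_addC trop_add0.

HB.instance Definition _ :=
  GRing.Nmodule_isComNzSemiRing.Build (tropical R)
    trop_mulA trop_mulC trop_mul1 trop_mulDl trop_mul0 trop_1neq0.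
End Tropical.

Definition upper_triangular (R : realType) (k : nat)
    (A : 'M[tropical R]_k) : bool :=
  [forall i : 'I_k, forall j : 'I_k, (j < i)%N ==> (A i j == None)].

Definition UT (R : realType) (k : nat) : Type :=
  {A : 'M[tropical R]_k | upper_triangular A}.

HB.instance Definition _ (R : realType) (k : nat) := Choice.on (UT R k).

Section UpperTriangular.
Variables (R : realType) (k : nat).
Implicit Types A B C : UT R k.
Local Open Scope ring_scope.

Fact UT_mul_proof A B : upper_triangular (val A *m val B).
Proof.
apply/forallP => i; apply/forallP => j; apply/implyP => ltji.
rewrite mxE; apply/eqP; apply: (@big1 (tropical R)) => l _.
have [ltli|leil] := ltnP l i.
  move/forallP/(_ i)/forallP/(_ l): (valP A).
  by rewrite ltli => /eqP->; apply: mul0r.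
move/forallP/(_ l)/forallP/(_ j): (valP B).
by rewrite (leq_trans ltji leil) => /eqP->; apply: mulr0.
Qed.

Definition UT_mul A B : UT R k := exist _ (val A *m val B) (UT_mul_proof A B).

Fact UT_mulA : associative UT_mul.
Proof. by move=> A B C; apply: val_inj; rewrite /= mulmxA. Qed.

HB.instance Definition _ := isSemigroup.Build (UT R k) UT_mulA.
End UpperTriangular.

(* Main.v *)
Require Import Defs.
From HB Require Import structures.
From mathcomp Require Import all_boot all_order all_algebra.
From mathcomp Require Import boolp reals.
From mathcomp Require Import zify ring.

(** The varieties are compared by means of one family of identities, indexed by
    [m >= 1]: the identity of index [m] holds in UT_k for [k <= m]
    ([UT_satisfies]) and in P_m ([plactic_satisfies]), and fails in P_n and UT_n
    for [n > m] ([plactic_fails], [UT_fails]). If P_n and UT_k satisfy the same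
    identities, then [k < n] contradicts the identity of index [n - 1], and
    [k > n] contradicts the identity of index [n].

    Triangular tropical matrices are treated as weighted automata whose states
    move up in a poset; the entries of a product are the maximal weights of
    runs. The plactic monoid P_n has a faithful representation of this kind on
    the sets of letters: a run is an increasing sequence of sets, and it scores
    one point for each letter that belongs to its set. The scores are invariant
    under the Knuth relations ([knuth_dominated]). They determine the tableau,
    because the best score of a run of j-element sets of letters below [i] is
    the number of entries below [i] in the first [j] rows; so words with the same
    scores are congruent ([dominated_congruence]).

    Let A and B be two words with the same content. They have the same weight on
    loops. Let Y = B^K A B^g A ... A B^g with [m] factors A, and let Y' be
    obtained by replacing the first A by B. The identity equates two words that
    are built from Y and Y' by surrounding them, at several scales, by all the
    variants Z of Y of the same length, beginning with enough factors B, over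
    which it is more expensive to cross a certain valley (see below). If a run
    stays constant in the surroundings of some scale, then its passage through
    the centre can be moved into the surroundings on the left or on the right,
    without loss for one of the two choices, as soon as its part over Y can be
    replaced by a run over some Z ([tower_transfer]). The centre no longer
    matters then, and the two sides of the identity have the same maximal
    weights.

    It remains to replace Y by some Z ([Y_replaceable]). If the run does not move
    at some A, this A is replaced by B. Otherwise the run stays for a while at
    some state in each gap between the A, and these states form a strict chain
    of [m + 1] elements. This is impossible in UT_k for [k <= m]. In P_m the loop
    weights of [m + 1] sets are linear functions of their indicator vectors,
    which are [m + 1] vectors in dimension [m], so they satisfy an integral
    relation with sum zero. Changing the lengths of the gaps by the coefficients
    of the relation changes neither the weight of the run nor the length of the
    word.

    The identity fails for longest nondecreasing subsequences, which are
    invariants of P_n and are computed by triangular matrices. With suitable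
    words A and B, a subsequence must go up from the letter 0 to the letter [m]
    with one factor A for each step, and loses [valley i] points for each factor
    read at an inner letter [i] ([block_step_cost]). Over Y the loss is the
    sum of the gaps weighted by the [valley i], and it is larger over every Z,
    so it is larger over the side of the identity that is built from Y'
    ([chain_separates]). The weights [valley i] are powers of a number larger
    than all the coefficients of the relations above, so a relation never leaves
    the loss unchanged, and after a change of sign it increases the loss. *)

Set Implicit Arguments.
Unset Strict Implicit.
Unset Printing Implicit Defensive.

Import Order.TTheory GRing.Theory Num.Theory.

(** * Runs of weighted automata *)
Section Run.
Local Open Scope ring_scope.
Variables (F : nmodType) (X S : Type).
Variable step : X -> S -> S -> F -> Prop.

(** The entries of a product of tropical matrices are the maximal weights of
    the paths labelled by the word. Keeping all the paths, as a relation,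
    instead of the maximum lets a whole word play the role of a letter (see
    [run_flatten]) and needs no value for the missing edges. *)
Fixpoint run (w : seq X) (P Q : S) (v : F) : Prop :=
  if w is x :: w' then
    exists T r s, [/\ step x P T r, run w' T Q s & v = r + s]
  else P = Q /\ v = 0.

Lemma run_cat w1 w2 P Q v :
  run (w1 ++ w2) P Q v <->
  exists T r s, [/\ run w1 P T r, run w2 T Q s & v = r + s].
Proof.
elim: w1 P v => [|x w1 IH] P v /=; split.
- by move=> h; exists P, 0, v; split; rewrite ?add0r.
- by move=> [T [r [s [[-> ->] h ->]]]]; rewrite add0r.
- move=> [T [r [s [h1 /IH[U [r' [s' [h2 h3 ->]]]] ->]]]].
  by exists U, (r + r'), s'; split; rewrite ?addrA //; exists T, r, r'.
- move=> [T [r [s [[U [r' [s' [h1 h2 ->]]]] h3 ->]]]].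
  by exists U, r', (s' + s); split; rewrite ?addrA //; apply/IH; exists T, s', s.
Qed.

Lemma run_catI w1 w2 P T Q r s :
  run w1 P T r -> run w2 T Q s -> run (w1 ++ w2) P Q (r + s).
Proof. by move=> h1 h2; apply/run_cat; exists T, r, s. Qed.

End Run.

Lemma run_flatten (F : nmodType) (X Y S : Type) (step : X -> S -> S -> F -> Prop)
    (phi : Y -> seq X) w P Q v :
  run (fun y => run step (phi y)) w P Q v <->
  run step (flatten (map phi w)) P Q v.
Proof.
elim: w P v => [|y w IH] P v //=; split.
  by move=> [T [r [s [h /IH h' ->]]]]; apply: run_catI h h'.
by move=> /run_cat[T [r [s [h /IH h' ->]]]]; exists T, r, s.
Qed.

Section Dominated.
Local Open Scope ring_scope.
Variables (F : realDomainType) (X S : Type).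
Variable step : X -> S -> S -> F -> Prop.

(** Two words that dominate each other have the same maximal weights. *)
Definition dominated (w w' : seq X) : Prop :=
  forall P Q v, run step w P Q v -> exists2 v', v <= v' & run step w' P Q v'.

Lemma dominated_refl w : dominated w w.
Proof. by move=> P Q v; exists v. Qed.

Lemma dominated_trans w1 w2 w3 :
  dominated w1 w2 -> dominated w2 w3 -> dominated w1 w3.
Proof.
move=> h h' P Q v /h[v' le1 /h'[v'' le2 h'']].
by exists v'' => //; apply: le_trans le2.
Qed.

Lemma dominated_cat w1 w1' w2 w2' :
  dominated w1 w1' -> dominated w2 w2' -> dominated (w1 ++ w2) (w1' ++ w2').
Proof.
move=> h1 h2 P Q v /run_cat[T [r [s [/h1[r' ler hr] /h2[s' les hs] ->]]]].
by exists (r' + s'); [apply: lerD|apply: run_catI hr hs].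
Qed.

End Dominated.

(** * Automata over a finite poset *)
Section Poset.
Local Open Scope ring_scope.
Variables (F : realDomainType) (X : eqType) (S : finType) (le : rel S).
Variable step : X -> S -> S -> F -> Prop.
Hypotheses (leR : reflexive le) (leA : antisymmetric le) (leT : transitive le).
Hypothesis step_le : forall x P Q v, step x P Q v -> le P Q.

Lemma run_le w P Q v : run step w P Q v -> le P Q.
Proof.
elim: w P v => [|x w IH] P v /=; first by move=> [-> _]; apply: leR.
by move=> [T [r [s [/step_le h /IH h' _]]]]; apply: leT h h'.
Qed.

Section Diagonal.
Variable d : X -> S -> F.
Hypothesis step_diag : forall x P v, step x P P v -> v = d x P.

(** Edges go up, so a run with equal ends is a sequence of loops. *)
Lemma run_diagE w P v : run step w P P v <->
  {in w, forall x, step x P P (d x P)} /\ v = \sum_(x <- w) d x P.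
Proof.
elim: w v => [|x w IH] v /=; first by rewrite big_nil; split=> [[]|[]].
rewrite big_cons; split.
  move=> [T [r [s [h h' ->]]]].
  have eT : T = P by apply: leA; rewrite (step_le h) (run_le h').
  subst T; have -> := step_diag h; move: h' => /IH[h1 ->]; split=> // y.
  by rewrite inE => /orP[/eqP->|/h1//]; rewrite -(step_diag h).
move=> [h ->]; exists P, (d x P), (\sum_(x <- w) d x P); split=> //.
  by apply: h; rewrite inE eqxx.
by apply/IH; split=> // y hy; apply: h; rewrite inE hy orbT.
Qed.

(** This is why two words with the same content act in the same way on the
    runs that do not move. *)
Lemma run_diag_perm w w' P v :
  perm_eq w w' -> run step w P P v -> run step w' P P v.
Proof.
move=> pw /run_diagE[h ->]; apply/run_diagE; split; last exact: perm_big.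
by move=> x; rewrite -(perm_mem pw); apply: h.
Qed.
End Diagonal.

(** The measure that decreases each time the two ends of a run get strictly
    closer; all the pigeonhole arguments are inductions on it. *)
Definition width (P Q : S) : nat := #|[set T | le P T && le T Q]|.

Lemma width_lt P Q P' Q' : le P P' -> le P' Q' -> le Q' Q ->
  (P' != P) || (Q' != Q) -> (width P' Q' < width P Q)%N.
Proof.
move=> h1 h2 h3 ne; apply: proper_card; apply/properP; split.
  apply/subsetP => T; rewrite !inE => /andP[a b].
  by rewrite (leT h1 a) (leT b h3).
have hPQ : le P Q by apply: leT h1 (leT h2 h3).
case/orP: ne => ne; [exists P|exists Q]; rewrite ?inE ?leR ?hPQ //.
  by apply: contraNN ne => /andP[a _]; apply/eqP/leA; rewrite a h1.
by apply: contraNN ne => /andP[_ a]; apply/eqP/leA; rewrite a h3.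
Qed.

Lemma width_gt0 P Q : le P Q -> (0 < width P Q)%N.
Proof. by move=> h; apply/card_gt0P; exists P; rewrite inE leR h. Qed.

Lemma width_le P Q : (width P Q <= #|S|)%N.
Proof. exact: max_card. Qed.

End Poset.

(** * Self-similar words and the exchange argument *)
Section Tower.
Variable A : eqType.
Variable Ms : seq (seq A).

(** [tower h Z] has [Z] in its centre, and each level surrounds the previous
    one, on both sides, by copies of the previous level in which the centre has
    been replaced by the members of [Ms]. If the tower is high, a run, which moves
    only a bounded number of times, is constant in the surroundings of some
    level. There the previous level, with a member of [Ms] in its centre, is
    available both before and after the central copy. *)
Fixpoint tower h (Z : seq A) : seq A :=
  if h is h'.+1 then
    let Om := flatten [seq tower h' V | V <- Ms] in Om ++ tower h' Z ++ Om
  else Z.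

(** Apart from its centre, a tower is a product of members of [Ms]: whatever
    holds for products of members of [Ms] holds for a tower centred at one. *)
Lemma tower_split h : exists ps qs : seq (seq A),
  [/\ {subset ps <= Ms}, {subset qs <= Ms} &
      forall Z, tower h Z = flatten ps ++ Z ++ flatten qs].
Proof.
elim: h => [|h [ps [qs [hp hq e]]]] /=.
  by exists [::], [::]; split=> // Z; rewrite cats0.
have [rs [hr er]] : exists rs : seq (seq A), {subset rs <= Ms} /\
    flatten [seq tower h V | V <- Ms] = flatten rs.
  suff aux : forall Vs, {subset Vs <= Ms} -> exists rs : seq (seq A),
      {subset rs <= Ms} /\ flatten [seq tower h V | V <- Vs] = flatten rs.
    exact: aux.
  elim=> [|V Vs IH] hV; first by exists [::].
  have [|rs [hr er]] := IH; first by move=> W hW; apply: hV; rewrite inE hW orbT.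
  exists (ps ++ [:: V] ++ qs ++ rs); split=> [W|/=].
    rewrite !mem_cat inE => /or4P[/hp|/eqP->|/hq|/hr] //.
    by apply: hV; rewrite inE eqxx.
  by rewrite er e flatten_cat /= flatten_cat !catA.
exists (rs ++ ps), (qs ++ rs); split=> [W|W|Z].
- by rewrite mem_cat => /orP[/hr|/hp].
- by rewrite mem_cat => /orP[/hq|/hr].
- by rewrite er e !flatten_cat !catA.
Qed.

Lemma size_tower h Z Z' : size Z = size Z' -> size (tower h Z) = size (tower h Z').
Proof. by move=> e; elim: h => //= h IH; rewrite !size_cat IH. Qed.

Lemma size_tower_gt0 h Z : 0 < size Z -> 0 < size (tower h Z).
Proof. by move=> e; elim: h => //= h IH; rewrite !size_cat; lia. Qed.
End Tower.

Section Transfer.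
Local Open Scope ring_scope.
Variables (F : realDomainType) (A : eqType) (S : finType) (le : rel S).
Variable step : A -> S -> S -> F -> Prop.
Variable c : S -> F.
Hypotheses (leR : reflexive le) (leA : antisymmetric le) (leT : transitive le).
Hypothesis step_le : forall x P Q v, step x P Q v -> le P Q.
Hypothesis step_diag : forall x P v, step x P P v -> v = c P.
Hypothesis step_swap : forall x y P v, step x P P v -> step y P P v.

Local Notation run := (run step).

(** All the letters have the same weight on the loops, so once a state has been
    kept over some letter it can be kept over any word. *)
Lemma run_const w P v : run w P P v -> w != [::] ->
  v = c P *+ size w /\ forall w', run w' P P (c P *+ size w').
Proof.
move=> /(run_diagE leR leA leT step_le (d := fun _ => c) step_diag)[h ->] w0.
rewrite big_const_seq count_predT iter_addr_0; split=> // w'.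
apply/(run_diagE leR leA leT step_le (d := fun _ => c) step_diag).
rewrite big_const_seq count_predT iter_addr_0; split=> // x _.
case: w w0 h => [//|y w] _ h.
by apply: (@step_swap y); apply: h; rewrite inE eqxx.
Qed.

Variables (Ms : seq (seq A)) (N : nat).
Hypothesis N_gt0 : (0 < N)%N.
Hypothesis size_Ms : {in Ms, forall Z, size Z = N}.

Definition replaceable Y := forall P Q v, run Y P Q v ->
  exists Z v', [/\ Z \in Ms, v <= v' & run Z P Q v'].

Lemma replaceable_mem Y : Y \in Ms -> replaceable Y.
Proof. by move=> h P Q v hv; exists Y, v. Qed.

Lemma replaceable_tower Y h P Q v : replaceable Y -> run (tower Ms h Y) P Q v ->
  exists Z v', [/\ Z \in Ms, v <= v' & run (tower Ms h Z) P Q v'].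
Proof.
move=> hY; have [ps [qs [_ _ e]]] := tower_split Ms h.
rewrite e => /run_cat[T [r [s [h1 /run_cat[U [r' [s' [h2 h3 ->]]]] ->]]]].
have [Z [v' [hZ lev h2']]] := hY _ _ _ h2.
exists Z, (r + (v' + s')); split=> //; first by rewrite lerD2l lerD2r.
by rewrite e; apply: run_catI h1 (run_catI h2' h3).
Qed.

(** The exchange argument. If the run moves in the outermost surroundings, the
    induction applies to the inner tower. Otherwise it goes from [P] to [Q]
    over the inner tower only, and after replacing [Y] by some [Z] of [Ms] of
    the same length this passage exists in both surroundings. Moving the
    passage to the right turns a number of loops at [Q] into loops at [P],
    moving it to the left does the opposite, so one of the two does not lose
    weight. The centre is then crossed without moving, and may be anything. *)
Lemma tower_transfer Y Y' h P Q v : replaceable Y -> size Y = N -> size Y' = N ->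
  (width le P Q <= h)%N -> run (tower Ms h Y) P Q v ->
  exists2 v', v <= v' & run (tower Ms h Y') P Q v'.
Proof.
move=> hY sY sY'; elim: h P Q v => [|h IH] P Q v hw hrun.
  by have := width_gt0 leR (run_le leR leT step_le hrun); rewrite leqNgt ltnS hw.
move: hrun; rewrite [tower _ _ _]/= [tower Ms h.+1 Y']/=.
set Om := flatten _; move=> /run_cat[P1 [r1 [s [h1 /run_cat[Q1 [r2 [r3 [h2 h3 ->]]]] ->]]]].
have [[le1 le2] le3] := (run_le leR leT step_le h1, run_le leR leT step_le h2,
  run_le leR leT step_le h3).
have [ne|] := boolP ((P1 != P) || (Q1 != Q)).
  have lt_h := leq_trans (width_lt leR leA leT le1 le2 le3 ne) hw.
  have [v' lev hv'] := IH _ _ _ lt_h h2.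
  exists (r1 + (v' + r3)); first by rewrite lerD2l lerD2r.
  exact: run_catI h1 (run_catI hv' h3).
rewrite negb_or !negbK => /andP[/eqP eP /eqP eQ]; subst P1 Q1.
have [Z [v' [hZ lev hv']]] := replaceable_tower hY h2.
have /(map_f (tower Ms h))/splitPr := hZ.
move eqs: (map _ _) => ss hs; case: hs eqs => p1 p2 eqs.
pose f1 := flatten p1; pose f2 := flatten p2.
have eOm : Om = f1 ++ tower Ms h Z ++ f2 by rewrite /Om eqs flatten_cat.
have Om0 : Om != [::].
  by rewrite -size_eq0 -lt0n eOm !size_cat addnCA ltn_addr // size_tower_gt0 // size_Ms.
have [er1 cP] := run_const h1 Om0; have [er3 cQ] := run_const h3 Om0.
have eL : size (tower Ms h Z) = size (tower Ms h Y') by apply: size_tower; rewrite size_Ms.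
have sOm : size Om = (size f1 + size (tower Ms h Y') + size f2)%N.
  by rewrite eOm !size_cat eL addnA.
have [lec|lec] := leP (c Q) (c P).
  (* staying at [P] is at least as good as staying at [Q]: move right *)
- exists (r1 + (c P *+ size (tower Ms h Y') + (c P *+ size f1 + (v' + c Q *+ size f2)))).
    rewrite er3 sOm !mulrnDr lerD2l !addrA lerD2r -addrA addrC.
    by apply: lerD => //; rewrite addrC; apply: lerD; rewrite lerMn2r lec orbT.
  apply: run_catI h1 _; apply: run_catI (cP _) _; rewrite eOm.
  exact: run_catI (cP _) (run_catI hv' (cQ _)).
  (* staying at [Q] is better: move left *)
- exists ((c P *+ size f1 + (v' + c Q *+ size f2)) + (c Q *+ size (tower Ms h Y') + r3)).
    rewrite er1 sOm !mulrnDr !addrA lerD2r -!addrA lerD2l.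
    rewrite [leLHS]addrA [leLHS]addrC; apply: lerD => //.
    by rewrite addrC; apply: lerD; rewrite lerMn2r (ltW lec) orbT.
  rewrite eOm; apply: run_catI (run_catI (cP _) (run_catI hv' (cQ _))) _.
  by apply: run_catI (cQ _) _; rewrite -eOm.
Qed.

End Transfer.

(** * Words with prescribed gaps *)

(** The letter [true] stands for a word called A and [false] for a word B with
    the same content; [gap_word g gs] is B^g A B^g1 A ... A B^gr for
    [gs = [:: g1; ...; gr]]. *)
Fixpoint gap_word (g : nat) (gs : seq nat) : seq bool :=
  nseq g false ++ (if gs is g' :: gs' then true :: gap_word g' gs' else [::]).

Lemma gap_wordE g gs : gap_word g gs =
  nseq g false ++ (if gs is g' :: gs' then true :: gap_word g' gs' else [::]).
Proof. by case: gs. Qed.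

Lemma gap_word_merge g g' gs :
  nseq g false ++ false :: gap_word g' gs = gap_word (g + g'.+1) gs.
Proof. by rewrite !gap_wordE nseqD -catA. Qed.

Lemma size_gap_word g gs : size (gap_word g gs) = g + sumn gs + size gs.
Proof.
elim: gs g => [|g' gs IH] g; rewrite gap_wordE size_cat size_nseq /=; first lia.
by rewrite IH; lia.
Qed.

Definition shift (gs : seq nat) (ds : seq int) : seq nat :=
  [seq absz (p.1%:Z + p.2)%R | p <- zip gs ds].

Lemma size_shift gs ds : size ds = size gs -> size (shift gs ds) = size gs.
Proof. by move=> e; rewrite size_map size1_zip ?e. Qed.

Section GapRuns.
Local Open Scope ring_scope.
Variables (F : realDomainType) (S : finType) (le : rel S).
Variable step : bool -> S -> S -> F -> Prop.
Variable c : S -> F.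
Hypotheses (leR : reflexive le) (leA : antisymmetric le) (leT : transitive le).
Hypothesis step_le : forall x P Q v, step x P Q v -> le P Q.
Hypothesis step_diag : forall x P v, step x P P v -> v = c P.
Hypothesis step_swap : forall x y P v, step x P P v -> step y P P v.
Variable D : nat.
Hypothesis D_gt0 : (0 < D)%N.

Local Notation run := (run step).
Definition slt : rel S := fun P Q => le P Q && (P != Q).

(** The change of weight when the stay at the i-th state of [Rs] is prolonged
    by the i-th entry of [ds]. *)
Definition lin (Rs : seq S) (ds : seq int) : F :=
  \sum_(p <- zip Rs ds) c p.1 *~ p.2.

(** Cut the gap into pieces of length [D]: there are at least as many pieces as
    states between the ends, so the run stays at some [R] over a whole piece,
    which can be shortened or prolonged by up to [D] letters. *)
Lemma stay_in_gap g P Q v : (D * width le P Q <= g)%N ->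
  run (nseq g false) P Q v ->
  exists R, [/\ le P R, le R Q & forall d : int, (absz d <= D)%N ->
    run (nseq (absz (g%:Z + d)) false) P Q (v + c R *~ d)].
Proof.
move: {2}(width le P Q) (leqnn (width le P Q)) => w.
elim: w g P v => [|w IH] g P v hw hg hrun.
  by have := width_gt0 leR (run_le leR leT step_le hrun); rewrite leqNgt ltnS hw.
have w0 := width_gt0 leR (run_le leR leT step_le hrun).
have Dg : (D <= g)%N by apply: leq_trans hg; rewrite leq_pmulr.
move: (hrun); rewrite -(subnKC Dg) nseqD => /run_cat[P' [r [s [h1 h2 ev]]]].
have [le1 le2] := (run_le leR leT step_le h1, run_le leR leT step_le h2).
have [eP|ne] := eqVneq P' P.
- subst P'; exists P; split=> // d hd.
  have D0 : nseq D false != [::] by rewrite -size_eq0 size_nseq -lt0n.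
  have [er cP] := run_const leR leA leT step_le step_diag step_swap h1 D0.
  rewrite size_nseq in er.
  have -> : absz ((D + (g - D))%N%:Z + d) = (absz (D%:Z + d)%R + (g - D))%N by lia.
  rewrite nseqD.
  have -> : v + c P *~ d = c P *+ size (nseq (absz (D%:Z + d)) false) + s.
    rewrite ev er size_nseq addrAC; congr (_ + _).
    by rewrite !pmulrn -mulrzDr; congr (_ *~ _); lia.
  exact: run_catI (cP _) h2.
- have lt_w : (width le P' Q < width le P Q)%N.
    by apply: width_lt => //; rewrite ne.
  have [||R [leR1 leR2 hR]] := IH (g - D)%N P' s _ _ h2.
  + by rewrite -ltnS (leq_trans lt_w).
  + rewrite -(leq_add2r D) subnK // -mulnSr; apply: leq_trans hg.
    by rewrite leq_mul2l lt_w orbT.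
  exists R; split=> //; first exact: leT le1 leR1.
  move=> d hd.
  have w1 := width_gt0 leR le2.
  have : (D * 2 <= g)%N by apply: leq_trans hg; rewrite leq_mul2l; apply/orP; right; lia.
  move=> D2g.
  have -> : absz ((D + (g - D))%N%:Z + d) = (D + absz ((g - D)%N%:Z + d)%R)%N by lia.
  by rewrite nseqD ev -addrA; apply: run_catI h1 (hR d hd).
Qed.

(** Either some A is read without moving, and it may be replaced by a B, which
    merges two gaps; or every A moves the run, the stays found in the
    consecutive gaps form a strict chain, and the lengths of all the gaps may
    be changed independently. *)
Lemma gap_word_run g gs P Q v :
  all (fun h => D * #|S| <= h)%N (g :: gs) -> run (gap_word g gs) P Q v ->
  (exists g' gs', [/\ (size gs' < size gs)%N,
     size (gap_word g' gs') = size (gap_word g gs), (g <= g')%N &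
     run (gap_word g' gs') P Q v]) \/
  (exists R Rs, [/\ size Rs = size gs, le P R, path slt R Rs &
     forall d ds, size ds = size gs -> all (fun e => absz e <= D)%N (d :: ds) ->
       run (gap_word (absz (g%:Z + d)) (shift gs ds)) P Q
           (v + lin (R :: Rs) (d :: ds))]).
Proof.
elim: gs g P v => [|g1 gs IH] g P v /= /andP[hg].
  move=> _; rewrite cats0 => hr; right.
  have [||R [leR1 leR2 hR]] := @stay_in_gap g P Q v => //.
    by apply: leq_trans hg; rewrite leq_mul2l width_le orbT.
  exists R, [::]; split=> // d [|//] _ /andP[hd _].
  by rewrite /= cats0 /lin big_cons big_nil addr0; apply: hR.
move=> /andP[hg1 hgs] /run_cat[P1 [r [s [h1 [P2 [r' [s' [h2 h3 ->]]]] ->]]]].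
have [e12|ne12] := eqVneq P1 P2.
  subst P2; left; exists (g + g1.+1)%N, gs; split=> //.
  - by rewrite !size_gap_word size_cat /= size_nseq size_gap_word; lia.
  - lia.
  - by rewrite -gap_word_merge; apply: run_catI h1 _; exists P1, r', s'; split=> //; apply: step_swap h2.
have hall : all (fun h => D * #|S| <= h)%N (g1 :: gs) by rewrite /= hg1.
have [[g' [gs' [lt_s es leg h]]]|[R1 [Rs [sRs leR1 hp hR1]]]] := IH _ _ _ hall h3.
  left; exists g, (g' :: gs'); split=> //.
    by rewrite size_cat [size (gap_word _ _)]size_cat /= es.
  by apply: run_catI h1 _; exists P2, r', s'.
right; have [||R [leR2 leR3 hR]] := @stay_in_gap g P P1 r => //.
  by apply: leq_trans hg; rewrite leq_mul2l width_le orbT.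
exists R, (R1 :: Rs); split=> /=; rewrite ?sRs //.
  rewrite hp andbT /slt (leT leR3 (leT (step_le h2) leR1)) /=.
  apply: contraNN ne12 => /eqP eR; apply/eqP/leA; rewrite (step_le h2) /=.
  by apply: leT leR1 _; rewrite -eR.
move=> d [//|d1 ds] [sds] /andP[hd hds].
have -> : r + (r' + s') + lin [:: R, R1 & Rs] [:: d, d1 & ds] =
    (r + c R *~ d) + (r' + (s' + lin (R1 :: Rs) (d1 :: ds))).
  by rewrite {1}/lin [zip _ _]/= big_cons -/(lin (R1 :: Rs) (d1 :: ds)) /=; ring.
rewrite gap_wordE.
by apply: run_catI (hR d hd) _; exists P2, r', (s' + lin (R1 :: Rs) (d1 :: ds)); split=> //; apply: hR1.
Qed.

End GapRuns.

(** * The cost of crossing a valley *)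
Section Cost.
Variables (m eta : nat) (om : nat -> nat).

(** A bookkeeping automaton for the chain automaton below, on the states
    0, ..., m. A letter read at [s] costs [om s] if the state is kept, or if the
    letter is an A and the state becomes [s.+1]; every other move costs the
    large amount [eta]. As [om] will vanish at 0 and m only, the inner states
    are a valley that a cheap run crosses fast, with one A for each step. *)
Definition cost_step (x : bool) (s t : nat) (r : nat) : Prop :=
  s <= t /\ r = if (t == s) || (x && (t == s.+1)) then om s else eta.

Local Notation crun := (run cost_step).

Lemma crun_le w s t c : crun w s t c -> s <= t.
Proof.
elim: w s c => [|x w IH] s c /=; first by move=> [->].
by move=> [u [r [r' [[h _] /IH h' _]]]]; apply: leq_trans h h'.
Qed.

Fixpoint weighted_gaps (s g : nat) (gs : seq nat) : nat :=
  om s * g + (if gs is g' :: gs' then om s + weighted_gaps s.+1 g' gs' else 0).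

Lemma crun_gap g s t c :
  crun (nseq g false) s t c -> (t = s /\ c = om s * g) \/ eta <= c.
Proof.
elim: g s c => [|g IH] s c /=; first by move=> [-> ->]; left; split=> //; symmetry; exact: muln0.
move=> [u [r [r' [[le_su ->] /IH h ->]]]]; rewrite orbF.
case: eqP h => [->|_] h; last by right; rewrite leq_addr.
by case: h => [[-> ->]|h]; [left; rewrite mulnS|right; rewrite (leq_trans h) // leq_addl].
Qed.

(** With exactly as many A as steps to make, a run that avoids the cost [eta]
    has no choice: each A is a step, and the cost is read off the gaps. *)
Lemma crun_gap_word g gs s t c : crun (gap_word g gs) s t c ->
  s + size gs <= t -> eta <= c \/ (t = s + size gs /\ c = weighted_gaps s g gs).
Proof.
elim: gs g s c => [|g1 gs IH] g s c.
  rewrite /= cats0 => /crun_gap[[-> ->]|h] _; last by left.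
  by right; rewrite !addn0.
rewrite gap_wordE [size _]/=.
move=> /run_cat[s1 [r [r1 [/crun_gap h1 [s2 [r2 [r3 [[le12 e2] h3 ->]]]] ->]]]] le_t.
rewrite !natrDE.
case: h1 => [[es1 ->]|h1]; last by left; lia.
subst s1; case: ifP e2 => [e2 -> |_ ->]; last by left; lia.
have := IH _ _ _ h3.
case/orP: e2 => /eqP e2; subst s2.
  move=> [|h|[ht _]]; [lia|left; lia|lia].
by move=> [|h|[-> ->]] /=; [lia|left; lia|right; lia].
Qed.

Fixpoint weighted_shift (s : nat) (d : int) (ds : seq int) : int :=
  ((om s)%:Z * d +
   (if ds is d' :: ds' then weighted_shift s.+1 d' ds' else 0))%R.

Lemma weighted_gaps_shift D s g gs d ds : size ds = size gs ->
  all (fun h => D <= h) (g :: gs) -> all (fun e : int => absz e <= D) (d :: ds) ->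
  (weighted_gaps s (absz (g%:Z + d)%R) (shift gs ds))%:Z%R =
  ((weighted_gaps s g gs)%:Z + weighted_shift s d ds)%R.
Proof.
elim: gs ds s g d => [|g1 gs IH] [|d1 ds] s g d //=.
  move=> _ /andP[hg _] /andP[hd _]; rewrite !addn0 addr0 !PoszM gez0_abs; last lia.
  by rewrite mulrDr.
move=> [sds] /andP[hg hgs] /andP[hd hds].
rewrite -/(shift gs ds) !PoszD IH // !PoszM gez0_abs; last lia.
by rewrite mulrDr; lia.
Qed.

Variables (theta N : nat).

(** The long prefix of B forces a run that enters [Z] at an inner state to pay
    more than [theta] there. *)
Definition costly (Z : seq bool) : Prop :=
  [/\ size Z = N, exists Z', Z = nseq theta.+1 false ++ Z' &
      forall c, crun Z 0 m c -> theta < c].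

(** A run over a product of costly words either crosses the valley inside one
    factor, or is at an inner state at the beginning of some factor. *)
Lemma crun_costly_cat Zs s c : theta < eta ->
  (forall i, 0 < i < m -> 0 < om i) -> (forall Z, Z \in Zs -> costly Z) ->
  s < m -> crun (flatten Zs) s m c -> theta < c.
Proof.
move=> lt_eta om_gt0; elim: Zs s c => [|Z Zs IH] s c hZs lt_sm.
  by move=> [e _]; rewrite e ltnn in lt_sm.
have [_ [Z' eZ] hZ] := hZs Z (mem_head _ _).
rewrite [flatten _]/= => /run_cat[s1 [r [r' [h1 h2 ->]]]]; rewrite natrDE.
have [s0|s_gt0] := posnP s; last first.
  suff : theta < r by lia.
  move: h1; rewrite eZ => /run_cat[s2 [a [b [/crun_gap ha _ ->]]]]; rewrite natrDE.
  have : 0 < om s by apply: om_gt0; rewrite s_gt0.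
  by case: ha => [[_ ->]|ha]; nia.
subst s; have := crun_le h2; rewrite leq_eqVlt => /orP[/eqP e|lt1].
  by subst s1; have := hZ _ h1; lia.
suff : theta < r' by lia.
by apply: IH lt1 h2 => W hW; apply: hZs; rewrite inE hW orbT.
Qed.

End Cost.

(** * A sufficient condition for the identity *)
Lemma size_gap_word_shift D g gs d ds : size ds = size gs ->
  all (fun h => D <= h)%N (g :: gs) -> all (fun e => absz e <= D)%N (d :: ds) ->
  (d + \sum_(e <- ds) e = 0)%R ->
  size (gap_word (absz (g%:Z + d)%R) (shift gs ds)) = size (gap_word g gs).
Proof.
move=> sds; rewrite !size_gap_word size_shift // => hg hd e0.
congr (_ + _)%N; apply/eqP; rewrite -eqz_nat; apply/eqP.
rewrite -[RHS]addr0 -e0 {e0}.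
elim: gs ds sds g d hg hd => [|g1 gs IH] [|d1 ds] //= sds g d /andP[hg hgs] /andP[hd hds].
  by rewrite big_nil; clear -hg hd; lia.
rewrite big_cons; have := IH ds _ g1 d1 hgs hds.
case: sds => sds /(_ sds) /=; rewrite -/(shift gs ds); clear -hg hd; lia.
Qed.

Lemma nseq_prefix a b w : (a <= b)%N ->
  exists w', nseq b false ++ w = nseq a false ++ w'.
Proof. by move=> h; exists (nseq (b - a) false ++ w); rewrite catA -nseqD subnKC. Qed.

Section Core.
Local Open Scope ring_scope.
Variables (F : realDomainType) (S : finType) (le : rel S).
Variable step : bool -> S -> S -> F -> Prop.
Variable c : S -> F.
Hypotheses (leR : reflexive le) (leA : antisymmetric le) (leT : transitive le).
Hypothesis step_le : forall x P Q v, step x P Q v -> le P Q.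
Hypothesis step_diag : forall x P v, step x P P v -> v = c P.
Hypothesis step_swap : forall x y P v, step x P P v -> step y P P v.
Variables (m D K k eta : nat) (om : nat -> nat).
Hypothesis D_gt0 : (0 < D)%N.
Hypothesis m_gt0 : (0 < m)%N.

(** Along every strict chain of [m + 1] states there is an integral relation
    between the loop weights, with sum zero so that changing the gaps by it
    preserves the length, and which makes the crossing of the valley more
    expensive. A poset without such chains satisfies this trivially. *)
Definition relations : Prop := forall R Rs, size Rs = m -> path (slt le) R Rs ->
  exists d ds, [/\ size ds = m, all (fun e => absz e <= D)%N (d :: ds),
    d + \sum_(e <- ds) e = 0, lin c (R :: Rs) (d :: ds) = 0 &
    0 < weighted_shift om 0 d ds].
Hypothesis rel : relations.

Let Y := gap_word K (nseq m k).
Let Y' := gap_word (K + k.+1) (nseq m.-1 k).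
Let theta := weighted_gaps om 0 K (nseq m k).
Hypothesis hk : (D * #|S| <= k)%N.
Hypothesis hK : (D * #|S| <= K)%N.
Hypothesis Dk : (D <= k)%N.
Hypothesis hKt : (theta.+1 + D <= K)%N.
Hypothesis heta : (theta < eta)%N.
Variable Ms : seq (seq bool).
Hypothesis hMs : forall Z, Z \in Ms <-> costly m eta om theta (size Y) Z.

Lemma few_costly g gs : (size gs < m)%N -> size (gap_word g gs) = size Y ->
  (K <= g)%N -> gap_word g gs \in Ms.
Proof.
move=> lt_s es leg; apply/hMs; split=> //.
  by rewrite gap_wordE; apply: nseq_prefix; lia.
move=> c' /crun_gap_word[]; rewrite ?add0n; first exact: ltnW.
  by move=> h; apply: leq_trans heta h.
by move=> [e _]; rewrite -e ltnn in lt_s.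
Qed.

(** Over [Y], a run that does not move at some A allows this A to be replaced by
    a B, after which there are too few A to cross the valley cheaply. If all the
    A move the run, changing the gaps by a relation along the chain of its stays
    gives a costly word over which the run has the same weight. *)
Lemma Y_replaceable : replaceable step Ms Y.
Proof.
have hall : all (fun h => D * #|S| <= h)%N (K :: nseq m k).
  by rewrite /= hK all_nseq hk orbT.
have hallD : all (fun h => D <= h)%N (K :: nseq m k).
  by rewrite /= all_nseq Dk orbT andbT; lia.
move=> P Q v hv.
have [] := gap_word_run leR leA leT step_le step_diag step_swap D_gt0 hall hv.
  move=> [g' [gs' [lt_s es leg h]]]; exists (gap_word g' gs'), v; split=> //.
  by apply: few_costly => //; rewrite size_nseq in lt_s.
move=> [R [Rs [sRs leR1 hp hR]]]; rewrite size_nseq in sRs.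
have [d [ds [sds hds e0 el w_gt0]]] := rel sRs hp.
have sds' : size ds = size (nseq m k) by rewrite size_nseq.
have := hR d ds sds' hds; rewrite el addr0 => h.
exists (gap_word (absz (K%:Z + d)) (shift (nseq m k) ds)), v; split=> //.
apply/hMs; split; first exact: (size_gap_word_shift (D := D)).
  rewrite gap_wordE; apply: nseq_prefix.
  by move: hds => /= /andP[hd _]; lia.
move=> c' /crun_gap_word[]; first by rewrite add0n size_shift // size_nseq.
  by move=> h'; apply: leq_trans heta h'.
move=> [_ ->]; rewrite -ltz_nat (weighted_gaps_shift _ _ sds' hallD hds) -/theta.
lia.
Qed.

Lemma size_Y' : size Y' = size Y.
Proof. by rewrite !size_gap_word !size_nseq !sumn_nseq; case: m m_gt0 => //= p _; nia. Qed.

Lemma Y'_in : Y' \in Ms.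
Proof. by apply: few_costly; rewrite ?size_Y' ?size_nseq ?leq_addr // prednK. Qed.

Theorem tower_equiv h : (#|S| <= h)%N ->
  dominated step (tower Ms h Y) (tower Ms h Y') /\
  dominated step (tower Ms h Y') (tower Ms h Y).
Proof.
move=> hh; have hw P Q : (width le P Q <= h)%N by apply: leq_trans (width_le _ _ _) hh.
have N_gt0 : (0 < size Y)%N by rewrite size_gap_word size_nseq; lia.
have hN : {in Ms, forall Z, size Z = size Y} by move=> Z /hMs[].
by split=> P Q v h'; apply: (tower_transfer leR leA leT step_le step_diag step_swap
  N_gt0 hN _ _ _ (hw P Q) h'); rewrite ?size_Y' //;
  [apply: Y_replaceable | apply: replaceable_mem Y'_in].
Qed.

End Core.

(** * The automaton of nondecreasing subsequences *)
Section ChainAutomaton.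

(** The maximal weight of a run from [s] to [t] over a word is the length of its
    longest nondecreasing subsequence with letters between [s] and [t]. *)
Definition chain_step (y s t r : nat) : Prop := s <= t /\ r = (s <= y <= t) :> nat.

Local Notation crun := (run chain_step).

Lemma chain_run_le w s t v : crun w s t v -> s <= t.
Proof.
elim: w s v => [|y w IH] s v /=; first by move=> [->].
by move=> [u [r [r' [[h _] /IH h' _]]]]; apply: leq_trans h h'.
Qed.

Lemma chain_run_const w s : crun w s s (count_mem s w).
Proof.
elim: w => [|y w IH] //=; exists s, (y == s : nat), (count_mem s w); split=> //.
by split=> //; rewrite eq_sym eqn_leq.
Qed.

Lemma chain_run_enter w s t : s <= t -> w != [::] ->
  exists2 v, count_mem t w <= v & crun w s t v.
Proof.
case: w => // y w le_st _; exists (addn (s <= y <= t) (count_mem t w)).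
  rewrite /= leq_add2r; case: eqP => // ->; by rewrite le_st leqnn.
by exists t, (s <= y <= t : nat), (count_mem t w); split=> //; apply: chain_run_const.
Qed.

Fixpoint decreasing (f : nat -> nat) (n : nat) : seq nat :=
  if n is n'.+1 then nseq (f n') n' ++ decreasing f n' else [::].

Lemma decreasing_lt f n : all (fun y => y < n) (decreasing f n).
Proof.
elim: n => //= n IH; rewrite all_cat all_nseq ltnSn orbT /=.
by apply: sub_all IH => y /ltnW.
Qed.

Lemma count_decreasing f n y : count_mem y (decreasing f n) = (y < n) * f y.
Proof.
elim: n => [|n IH] //=; rewrite count_cat count_nseq IH /=.
by case: (ltngtP y n) => [h|h|->]; rewrite ?eqxx ?ltnS; [rewrite ltnW //|..|rewrite leqnn]; lia.
Qed.

Lemma chain_run_nseq g y s t v : crun (nseq g y) s t v -> v <= g * (s <= y <= t).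
Proof.
elim: g s v => [|g IH] s v /=; first by move=> [_ ->].
move=> [u [r [r' [[le_su ->] h ->]]]]; have le_ut := chain_run_le h.
have := IH _ _ h; rewrite natrDE; lia.
Qed.

(** A nondecreasing subsequence of a weakly decreasing word is constant. *)
Lemma chain_run_decreasing f n s t v B : crun (decreasing f n) s t v ->
  (forall y, s <= y <= t -> f y <= B) -> v <= B.
Proof.
suff aux : crun (decreasing f n) s t v ->
    (forall y, s <= y <= t -> y < n -> f y <= B) -> v <= B.
  by move=> h hf; apply: aux => // y hy _; apply: hf.
elim: n s v B => [|n IH] s v B /=; first by move=> [_ ->].
move=> /run_cat[u [r [r' [h1 h2 ->]]]] hf; rewrite natrDE.
have := chain_run_nseq h1; have le_su := chain_run_le h1; have le_ut := chain_run_le h2.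
have [le_nu|lt_un] := leqP n u.
  have : r' <= 0 by apply: IH h2 _ => y; lia.
  have [le_sn|] := leqP s n; last by nia.
  have : f n <= B by apply: hf; lia.
  by nia.
have : r' <= B by apply: IH h2 _ => y hy hn; apply: hf; lia.
by nia.
Qed.

End ChainAutomaton.

#[local] Arguments decreasing : simpl never.

(** The letters [Some (t, true)] and [Some (t, false)] are spelled by decreasing
    words over the letters up to [t] and the letters above [t]. Written in this
    order they allow a nondecreasing subsequence to collect twice [eta] when it
    passes from some letter up to [t] to some letter above [t]; in the other
    order their product is decreasing and nothing is gained. The word A contains
    all these pairs in the first order, for decreasing [t], and B in the second
    one. Since the pair of [t] comes after the pairs of larger indices, at most
    one of the gains can be obtained within one A. The letter [None] only adjusts the
    content: keeping [s] over a whole block collects [V - om s] letters. *)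
Section Separation.
Variables (m R eta : nat) (om : nat -> nat).
Hypothesis om_eta : forall i, om i <= eta.
Hypothesis om_R : forall i, om i <= R.

Fixpoint crossings (x : bool) (n : nat) : seq (option (nat * bool)) :=
  if n is n'.+1 then [:: Some (n', x), Some (n', ~~ x) & crossings x n'] else [::].

Definition block (x : bool) : seq (option (nat * bool)) := None :: crossings x m.

Lemma perm_block x y : perm_eq (block x) (block y).
Proof.
rewrite /block perm_cons; elim: m => //= n IH.
case: x y IH => [] [] IH; rewrite /= ?perm_cons //.
  by rewrite (perm_catCA [:: _] [:: _]) /= !perm_cons.
by rewrite (perm_catCA [:: _] [:: _]) /= !perm_cons.
Qed.

Definition letter_word (l : option (nat * bool)) : seq nat :=
  match l with
  | None => decreasing (fun y => R - om y) m.+1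
  | Some (t, true) => decreasing (fun y => eta * (y <= t)) m.+1
  | Some (t, false) => decreasing (fun y => eta * (t < y)) m.+1
  end.

Definition spell (w : seq (option (nat * bool))) : seq nat :=
  flatten (map letter_word w).

Local Notation nrun := (run chain_step).
Let V := R + eta * m.

Lemma spell_cons l w : spell (l :: w) = letter_word l ++ spell w.
Proof. by []. Qed.

Lemma count_crossings x n y : y <= m -> count_mem y (spell (crossings x n)) = eta * n.
Proof.
move=> le_ym; elim: n => [|n IH]; first by rewrite muln0.
rewrite /= !spell_cons !count_cat IH.
by case: x {IH}; rewrite /= !count_decreasing ltnS le_ym; case: (leqP y n); lia.
Qed.

Lemma crossings_false n s t v :
  nrun (spell (crossings false n)) s t v -> v <= eta * n.
Proof.
elim: n s v => [|n IH] s v; first by move=> [_ ->].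
rewrite /= !spell_cons.
move=> /run_cat[u [r [r' [h1 /run_cat[u' [r1 [r2 [h2 /IH h3 ->]]]] ->]]]]; rewrite !natrDE.
have b1 : r <= eta * (n < u).
  by apply: chain_run_decreasing h1 _ => y hy; nia.
have b2 : r1 <= eta * (u <= n).
  by apply: chain_run_decreasing h2 _ => y hy; nia.
by have := leq_total u n; nia.
Qed.

(** Once the boundary of [t] has been crossed at the pair of [t], the state
    exceeds all the indices that remain. *)
Lemma crossings_true n s t v : nrun (spell (crossings true n)) s t v ->
  v <= eta * n + eta * ((s < t) && (s < n)).
Proof.
elim: n s v => [|n IH] s v; first by move=> [_ ->].
rewrite /= !spell_cons.
move=> /run_cat[u [r [r' [h1 /run_cat[u' [r1 [r2 [h2 h3 ->]]]] ->]]]]; rewrite !natrDE.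
have b1 : r <= eta * (s <= n).
  by apply: chain_run_decreasing h1 _ => y hy; nia.
have b2 : r1 <= eta * (n < u').
  by apply: chain_run_decreasing h2 _ => y hy; nia.
have := IH _ _ h3.
have := chain_run_le h1; have := chain_run_le h2; have := chain_run_le h3.
by case: (ltnP n u') b2; case: (leqP s n) b1; case: (ltnP s t); case: (ltnP u' t);
  case: (ltnP u' n); case: (ltnP s n.+1); rewrite /=; nia.
Qed.

Definition block_step (x : bool) : nat -> nat -> nat -> Prop :=
  nrun (spell (block x)).

(** Relative to a gain of [V] per block and of [eta] per unit of ascent, the
    loss of a run is at least its cost in the bookkeeping automaton. *)
Lemma block_step_cost x s t v : block_step x s t v ->
  exists2 c, cost_step eta om x s t c & v + c <= V + (t - s) * eta.
Proof.
move=> h; have le_st := chain_run_le h.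
eexists; first by split; [exact: le_st|reflexivity].
move: h; rewrite /block_step spell_cons => /run_cat[u [r [r' [h1 h2 ->]]]].
rewrite natrDE; have le_su := chain_run_le h1; have le_ut := chain_run_le h2.
have b1 : r <= R by apply: chain_run_decreasing h1 _ => y _; lia.
have b1' : u = s -> r <= R - om s.
  move=> e; subst u; apply: chain_run_decreasing h1 _ => y hy.
  by have -> : y = s by lia.
have oe := om_eta s; have oR := om_R s.
have b2 : r' <= eta * m + eta * (x && (u < t)).
  case: x h2 => h2; last by have := crossings_false h2; lia.
  by have := crossings_true h2; case: (u < t); case: (u < m) => /=; nia.
clear h2; rewrite /V; case: (eqVneq t s) => [e|ne] /=.
  have eu : u = s by lia.
  by have := b1' eu; move: b2; rewrite (_ : u < t = false); [case: x => /=; nia|lia].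
have lt_st : s < t by lia.
case: x b2 => /= b2; last by nia.
case: (eqVneq t s.+1) => [e|ne1].
  case: (eqVneq u s) => [eu|nu]; first by have := b1' eu; nia.
  have -> : t - s = 1 by lia.
  by move: b2; rewrite (_ : u < t = false); [nia|lia].
have : 2 <= t - s by lia.
case: (u < t) b2 => b2; nia.
Qed.

Lemma block_run_cost w s t v : run block_step w s t v ->
  exists2 c, run (cost_step eta om) w s t c & v + c <= size w * V + (t - s) * eta.
Proof.
elim: w s v => [|x w IH] s v /=.
  by move=> [-> ->]; exists 0; rewrite ?addn0.
move=> [u [r [r' [h1 h2 ->]]]].
have [c1 hc1 b1] := block_step_cost h1; have [c2 hc2 b2] := IH _ _ h2.
exists (c1 + c2)%R; first by exists u, c1, c2.
have le1 : s <= u := chain_run_le h1.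
have le2 := crun_le hc2.
rewrite !natrDE; nia.
Qed.

Lemma block_stay x s : s <= m ->
  exists2 v, V <= v + om s & block_step x s s v.
Proof.
move=> le_sm; exists (count_mem s (spell (block x))); last exact: chain_run_const.
rewrite spell_cons count_cat count_crossings // count_decreasing ltnS le_sm mul1n.
by have := om_R s; rewrite /V; lia.
Qed.

(** Keep [s] until the pair of index [s], and change to [s.+1] in its middle. *)
Lemma crossings_jump n s : s < m -> s < n -> 0 < eta ->
  exists2 v, eta * n.+1 <= v & nrun (spell (crossings true n)) s s.+1 v.
Proof.
move=> lt_sm; elim: n => // n IH lt_sn eta_gt0; rewrite /= !spell_cons.
have c1 : count_mem s (letter_word (Some (n, true))) = eta.
  by rewrite /= count_decreasing ltnS (ltnW lt_sm) (_ : s <= n) ?muln1 ?mul1n.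
have [e|ne] := eqVneq s n; last first.
  have [v hv hr] := IH ltac:(lia) eta_gt0.
  exists (count_mem s (letter_word (Some (n, true))) +
         (count_mem s (letter_word (Some (n, ~~ true))) + v))%R.
    by rewrite !natrDE c1; lia.
  by do !(apply: run_catI (chain_run_const _ _) _).
subst n; have ne : letter_word (Some (s, ~~ true)) != [::].
  apply/eqP => h; have := count_decreasing (fun y => eta * (s < y)) m.+1 s.+1.
  by rewrite [decreasing _ _]h /= ltnS lt_sm ltnSn !mul1n; lia.
have [v hv hr] := chain_run_enter (leqnSn s) ne.
exists (count_mem s (letter_word (Some (s, true))) + (v + count_mem s.+1 (spell (crossings true s))))%R.
  rewrite !natrDE c1 count_crossings //.
  move: hv; rewrite /= count_decreasing ltnS lt_sm ltnSn; lia.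
exact: run_catI (chain_run_const _ _) (run_catI hr (chain_run_const _ _)).
Qed.

Lemma block_jump s : s < m -> 0 < eta ->
  exists2 v, V + eta <= v + om s & block_step true s s.+1 v.
Proof.
move=> lt_sm eta_gt0; have [v hv hr] := crossings_jump lt_sm lt_sm eta_gt0.
exists (count_mem s (letter_word None) + v)%R; last exact: run_catI (chain_run_const _ _) hr.
rewrite natrDE /= count_decreasing ltnS (ltnW lt_sm) mul1n.
by have := om_R s; rewrite /V; lia.
Qed.

Lemma block_run_stay w s : s <= m ->
  exists2 v, size w * V <= v + om s * size w & run block_step w s s v.
Proof.
move=> le_sm; elim: w => [|x w [v hv hr]] /=; first by exists 0; rewrite ?muln0.
have [r hr1 h1] := block_stay x le_sm.
by exists (r + v)%R; [rewrite natrDE; nia|exists s, r, v].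
Qed.

Lemma block_run_gap_word g gs s : 0 < eta -> s + size gs <= m ->
  exists2 v, size (gap_word g gs) * V + size gs * eta <= v + weighted_gaps om s g gs &
    run block_step (gap_word g gs) s (s + size gs) v.
Proof.
move=> eta_gt0; elim: gs g s => [|g1 gs IH] g s /= le_m.
  rewrite cats0 !addn0; have [|v hv hr] := @block_run_stay (nseq g false) s; first lia.
  by exists v => //; move: hv; rewrite size_nseq; lia.
have [|v hv hr] := @block_run_stay (nseq g false) s; first lia.
have [|r hr1 h1] := @block_jump s _ eta_gt0; first lia.
have [|v' hv' hr'] := IH g1 s.+1; first lia.
exists (v + (r + v'))%R.
  by rewrite !natrDE size_cat /=; move: hv; rewrite size_nseq; nia.
apply: run_catI hr _; exists s.+1, r, v'; split=> //.
by rewrite addnS -addSn.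
Qed.

End Separation.

(** * The identity *)
Section Identity.
Variables m D L : nat.

(** A number written in base [D.+1] with digits of absolute value at most [D]
    vanishes only if all the digits do: a relation with coefficients bounded by
    [D] and some nonzero inner coefficient always changes the cost. *)
Definition valley (i : nat) : nat := if 0 < i < m then D.+1 ^ i else 0.

(** Long enough for [stay_in_gap] in posets of at most [L] elements. *)
Definition gap_size : nat := D * L + D.
Definition depth : nat := weighted_gaps valley 0 0 (nseq m gap_size).

(** Even shortened by [D], the first gap is longer than [depth]. *)
Definition margin : nat := depth.+1 + D + D * L.

(** Larger than [depth], so that a cheapest run over [core_word] makes no
    expensive move, and than each [valley i], as the chain automaton requires. *)
Definition penalty : nat := depth + D.+1 ^ m + 1.
Definition core_word : seq bool := gap_word margin (nseq m gap_size).

(** [core_word] with its first A replaced by a B. *)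
Definition core_word' : seq bool := gap_word (margin + gap_size.+1) (nseq m.-1 gap_size).

Definition costly_words : seq (seq bool) :=
  [seq Z <- map val (enum {: (size core_word).-tuple bool}) |
    `[< costly m penalty valley depth (size core_word) Z >] ].

Lemma mem_costly_words Z :
  Z \in costly_words <-> costly m penalty valley depth (size core_word) Z.
Proof.
rewrite mem_filter; split=> [/andP[/asboolP]//|h].
rewrite asboolT //=; case: (h) => /eqP sZ _ _.
by apply/mapP; exists (Tuple sZ) => //; rewrite mem_enum.
Qed.

Lemma depthE K : weighted_gaps valley 0 K (nseq m gap_size) = depth.
Proof. by rewrite /depth; case: m (erefl : valley 0 = 0) => [|p] /= ->. Qed.

Definition expand (w : seq bool) : seq (option (nat * bool)) :=
  flatten (map (block m) w).
Definition left_word := expand (tower costly_words L core_word).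
Definition right_word := expand (tower costly_words L core_word').

Lemma valley_penalty i : valley i <= penalty.
Proof.
rewrite /valley /penalty; case: ifP => // /andP[_ lt_im].
have : D.+1 ^ i <= D.+1 ^ m by rewrite leq_pexp2l // ltnW.
lia.
Qed.

Let letters := letter_word m penalty penalty valley.

Lemma core_word'_costly : 0 < m ->
  costly m penalty valley depth (size core_word) core_word'.
Proof.
move=> m_gt0; split.
- rewrite !size_gap_word !size_nseq !sumn_nseq; case: m m_gt0 => //= p _; nia.
- by rewrite /core_word' gap_wordE; apply: nseq_prefix; rewrite /margin; lia.
- move=> c /crun_gap_word[]; rewrite ?size_nseq ?add0n ?leq_pred // /penalty; lia.
Qed.

(** Over the left word the valley can be crossed in [core_word], at the cost
    [depth]. The right word is a product of costly words. *)
Theorem chain_separates : 0 < m ->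
  exists2 v, run chain_step (flatten (map letters left_word)) 0 m v &
    forall v', run chain_step (flatten (map letters right_word)) 0 m v' -> v' < v.
Proof.
move=> m_gt0; have om_le := valley_penalty.
have penalty_gt0 : 0 < penalty by rewrite /penalty; lia.
have valley0 : valley 0 = 0 by [].
have valleym : valley m = 0 by rewrite /valley ltnn andbF.
have expandE w : flatten (map letters (expand w)) =
    flatten (map (fun x => spell m penalty penalty valley (block m x)) w).
  elim: w => // x w IH.
  have -> : expand (x :: w) = block m x ++ expand w by [].
  by rewrite map_cat flatten_cat IH.
have [ps [qs [hps hqs tE]]] := tower_split costly_words L.
have [v1 hv1 hr1] := @block_run_stay m penalty penalty valley om_le (flatten ps) 0 (leq0n m).
have [|v2 hv2 hr2] := @block_run_gap_word m penalty penalty valley om_le margin (nseq m gap_size) 0 penalty_gt0.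
  by rewrite size_nseq.
have [v3 hv3 hr3] := @block_run_stay m penalty penalty valley om_le (flatten qs) m (leqnn m).
exists (v1 + (v2 + v3)).
  rewrite expandE; apply/run_flatten; rewrite tE.
  apply: run_catI hr1 (run_catI _ hr3).
  by move: hr2; rewrite size_nseq.
move=> v'; rewrite expandE => /run_flatten hr.
have [c hc hb] := block_run_cost om_le om_le hr.
have : depth < c.
  have e : tower costly_words L core_word' = flatten (ps ++ core_word' :: qs).
    by rewrite tE flatten_cat.
  move: hc; rewrite e; apply: (crun_costly_cat (N := size core_word)) => //.
  - by rewrite /penalty; lia.
  - by move=> i hi; rewrite /valley hi expn_gt0.
  - move=> Z; rewrite mem_cat inE => /or3P[/hps|/eqP->|/hqs];
      by [move=> /mem_costly_words|apply: core_word'_costly].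
have es : size (tower costly_words L core_word') = size (tower costly_words L core_word).
  by apply: size_tower; case: (core_word'_costly m_gt0).
rewrite es in hb; move: hv2 hb hv1 hv3; rewrite tE !size_cat depthE size_nseq valley0 valleym -/core_word.
move: (size _) => a; move: (size _) => b; move: (size _) => d; nia.
Qed.

Lemma left_right_neq : 0 < m -> left_word != right_word.
Proof.
move=> /chain_separates[v hl hr]; apply/eqP => e.
by have := hr v; rewrite -e ltnn => /(_ hl).
Qed.

Lemma expand_nnil w : w != [::] -> ~~ nilp (expand w).
Proof. by case: w. Qed.

Lemma left_word_nnil : 0 < m -> ~~ nilp left_word.
Proof.
move=> m_gt0; apply: expand_nnil; rewrite -size_eq0 -lt0n size_tower_gt0 //.
by rewrite size_gap_word /margin; lia.
Qed.

Lemma right_word_nnil : 0 < m -> ~~ nilp right_word.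
Proof.
move=> m_gt0; apply: expand_nnil; rewrite -size_eq0 -lt0n size_tower_gt0 //.
by rewrite size_gap_word /margin; lia.
Qed.

Section Holds.
Local Open Scope ring_scope.
Variables (F : realDomainType) (S : finType) (le : rel S).
Variable step : option (nat * bool) -> S -> S -> F -> Prop.
Variable d : option (nat * bool) -> S -> F.
Hypotheses (leR : reflexive le) (leA : antisymmetric le) (leT : transitive le).
Hypothesis step_le : forall x P Q v, step x P Q v -> le P Q.
Hypothesis step_diag : forall x P v, step x P P v -> v = d x P.

(** The statement about words in A and B applies to all automata over the
    alphabet of the identity, as A and B are permutations of each other. *)
Theorem left_right_equiv : (0 < m)%N -> (0 < D)%N -> (#|S| <= L)%N ->
  relations le (fun P => \sum_(x <- block m true) d x P) m D valley ->
  dominated step left_word right_word /\ dominated step right_word left_word.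
Proof.
move=> m_gt0 D_gt0 hL hrel.
pose bstep x := run step (block m x).
have ble x P Q v : bstep x P Q v -> le P Q.
  by move=> /(run_le leR leT step_le).
have bdiag x P v : bstep x P P v -> v = \sum_(y <- block m true) d y P.
  move=> /(run_diagE leR leA leT step_le step_diag)[_ ->].
  exact: perm_big (perm_block m x true).
have bswap x y P v : bstep x P P v -> bstep y P P v.
  by apply: (run_diag_perm leR leA leT step_le step_diag); apply: perm_block.
have hDL : (D * #|S| <= D * L)%N by rewrite leq_mul2l hL orbT.
have [||||||h1 h2] := @tower_equiv F S le bstep _ leR leA leT ble bdiag bswap
  m D margin gap_size penalty valley D_gt0 m_gt0 hrel _ _ _ _ _ costly_words _ L hL.
- by rewrite /gap_size; lia.
- by rewrite /margin; lia.
- by rewrite /gap_size; lia.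
- by rewrite depthE /margin; lia.
- by rewrite depthE /penalty; lia.
- by move=> Z; rewrite depthE; apply: mem_costly_words.
split=> P Q v /run_flatten; [move=> /h1|move=> /h2] => -[v' lev /run_flatten h'];
  by exists v'.
Qed.

End Holds.

End Identity.

(** * A tropical representation of the plactic monoid *)
Section SetAutomaton.
Variable n : nat.
Implicit Types (P Q T U : {set 'I_n}) (x y : 'I_n).

Definition below (P : {set 'I_n}) (z : nat) : nat := #|[set t in P | t < z]|.

Lemma below_le_card P z : below P z <= #|P|.
Proof. by apply: subset_leq_card; apply/subsetP => t; rewrite inE => /andP[]. Qed.

Lemma below_card P z : n <= z -> below P z = #|P|.
Proof.
move=> h; congr #|pred_of_set _|; apply/setP => t; rewrite inE.
by rewrite (leq_trans (ltn_ord t) h) andbT.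
Qed.

Lemma below0 P : below P 0 = 0.
Proof. by apply/eqP; rewrite cards_eq0; apply/eqP/setP => t; rewrite !inE andbF. Qed.

Lemma below_mono P z z' : z <= z' -> below P z <= below P z'.
Proof.
move=> h; apply: subset_leq_card; apply/subsetP => t.
by rewrite !inE => /andP[-> /= h']; apply: leq_trans h' h.
Qed.

Lemma belowS P x : below P x.+1 = below P x + (x \in P).
Proof.
rewrite /below; have [xP|xP] := boolP (x \in P).
  rewrite addn1 (cardsD1 x) !inE xP ltnSn add1n; congr (#|pred_of_set _|.+1).
  by apply/setP => t; rewrite !inE -val_eqE /= andbCA ltnS; congr andb; rewrite ltn_neqAle.
rewrite addn0; congr #|pred_of_set _|; apply/setP => t; rewrite !inE ltnS.
have [tP|//] := boolP (t \in P); rewrite /= [RHS]ltn_neqAle.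
by case: eqP => // /val_inj e; rewrite e (negPf xP) in tP.
Qed.

Lemma below_inj P Q : (forall z, below P z = below Q z) -> P = Q.
Proof.
move=> h; apply/setP => x; have := belowS P x; have := belowS Q x.
by rewrite !h; case: (x \in P); case: (x \in Q) => //=; lia.
Qed.

(** The componentwise order on sets of the same cardinality, listed in
    increasing order, expressed by counting functions. *)
Definition sle : rel {set 'I_n} := fun P Q =>
  (#|P| == #|Q|) && [forall z : 'I_n, below Q z <= below P z].

Lemma sleP P Q :
  reflect (#|P| = #|Q| /\ forall z, below Q z <= below P z) (sle P Q).
Proof.
apply: (iffP andP) => [[/eqP e /forallP h]|[-> h]]; split=> //.
  move=> z; have [lt_zn|le_nz] := ltnP z n; first exact: (h (Ordinal lt_zn)).
  by rewrite !below_card // e.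
exact/forallP.
Qed.

Lemma sle_card P Q : sle P Q -> #|P| = #|Q|. Proof. by case/sleP. Qed.

Lemma sle_below P Q z : sle P Q -> below Q z <= below P z.
Proof. by case/sleP. Qed.

Lemma sle_refl : reflexive sle.
Proof. by move=> P; apply/sleP. Qed.

Lemma sle_trans : transitive sle.
Proof.
move=> Q P T /sleP[e h] /sleP[e' h']; apply/sleP; rewrite e e'; split=> // z.
exact: leq_trans (h' z) (h z).
Qed.

Lemma sle_anti : antisymmetric sle.
Proof.
move=> P Q /andP[/sleP[_ h] /sleP[_ h']]; apply: below_inj => z.
by apply/eqP; rewrite eqn_leq h h'.
Qed.

Definition swap (x q : 'I_n) (P : {set 'I_n}) : {set 'I_n} := x |: P :\ q.

Lemma below_swap x q P z : x \notin P -> q \in P ->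
  below (swap x q P) z + (q < z) = below P z + (x < z).
Proof.
move=> xP qP; have xq : x != q by apply: contraNneq xP => ->.
rewrite /below (cardsD1 x) [in RHS](cardsD1 q) !inE eqxx qP /=.
suff -> : [set t in x |: P :\ q | t < z] :\ x = [set t in P | t < z] :\ q by rewrite addnC addnA addnAC.
apply/setP => t; rewrite !inE.
have [->|tx] := eqVneq t x; first by rewrite (negPf xP) andbF.
by have [->|tq] := eqVneq t q.
Qed.

Lemma card_swap x q P : x \notin P -> q \in P -> #|swap x q P| = #|P|.
Proof.
move=> xP qP; rewrite -(@below_card _ n) // -(@below_card P n) //.
by have := below_swap n xP qP; rewrite !ltn_ord => /addIn.
Qed.

Lemma mem_swap x q P t : t \in swap x q P = (t == x) || (t != q) && (t \in P).
Proof. by rewrite !inE. Qed.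

Lemma swap_up x q P : x \notin P -> q \in P -> q <= x -> sle P (swap x q P).
Proof.
move=> xP qP le; apply/sleP; rewrite card_swap //; split=> // z.
by have := below_swap z xP qP; lia.
Qed.

Lemma swap_down x q P : x \notin P -> q \in P -> x <= q -> sle (swap x q P) P.
Proof.
move=> xP qP le; apply/sleP; rewrite card_swap //; split=> // z.
by have := below_swap z xP qP; lia.
Qed.

Lemma below_gap P (q z z' : nat) : q < z -> z <= z' ->
  (forall t, t \in P -> t < z' -> t <= q) -> below P z = below P z'.
Proof.
move=> lt_qz le_zz' h; congr #|pred_of_set _|; apply/setP => t; rewrite !inE.
have [tP|//] := boolP (t \in P); rewrite /=; apply/idP/idP => ht.
  exact: leq_trans ht le_zz'.
exact: leq_ltn_trans (h t tP ht) lt_qz.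
Qed.

(** Unless [T] contains [x], replace by [x] the largest element of [T] below [x].
    Only this element is lost, so [T'] contains the elements of [T] above [x]. *)
Lemma raise_to T Q x : sle T Q -> x \in Q -> exists T',
  [/\ sle T T', sle T' Q, x \in T' &
   T' = T \/ exists q, [/\ q \in T, x \notin T, q < x,
      (forall t, t \in T -> t <= x -> t <= q) & T' = swap x q T]].
Proof.
move=> /sleP[eTQ hTQ] xQ; have [xT|xT] := boolP (x \in T).
  by exists T; split=> //; [apply: sle_refl|apply/sleP|left].
have : 0 < below T x.+1 by apply: leq_trans (hTQ _); rewrite belowS xQ addn1.
move=> /card_gt0P[t0 ht0].
have [q hq qmax] := @arg_maxnP _ t0 (fun t => t \in [set t in T | t < x.+1]) val ht0.
move: hq; rewrite inE ltnS => /andP[qT le_qx].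
have lt_qx : q < x.
  by rewrite ltn_neqAle le_qx andbT; apply: contraNneq xT => /val_inj <-.
have hmax t : t \in T -> t <= x -> t <= q by move=> tT tx; apply: qmax; rewrite inE tT ltnS.
have bS z := below_swap z xT qT.
exists (swap x q T); split.
- exact: swap_up.
- apply/sleP; rewrite card_swap //; split=> // z; have := bS z; have := hTQ z.
  have [le_zq|lt_qz] := leqP z q; first by lia.
  have [lt_xz|le_zx] := ltnP x z; first by lia.
  have e : below T z = below T x.+1.
    by apply: (below_gap lt_qz (leqW le_zx)) => t tT; rewrite ltnS; apply: hmax.
  have := hTQ x.+1; rewrite belowS xQ -e; have := below_mono Q le_zx; lia.
- by rewrite mem_swap eqxx.
- by right; exists q.
Qed.

(** The mirror image of [raise_to]: the smallest element of [Q] above [x] is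
    replaced by [x]. *)
Lemma lower_to T Q x : sle T Q -> x \in T -> exists Q',
  [/\ sle T Q', sle Q' Q, x \in Q' &
   Q' = Q \/ exists q, [/\ q \in Q, x \notin Q, x < q,
      (forall t, t \in Q -> x <= t -> q <= t) & Q' = swap x q Q]].
Proof.
move=> /sleP[eTQ hTQ] xT; have [xQ|xQ] := boolP (x \in Q).
  by exists Q; split=> //; [apply/sleP|apply: sle_refl|left].
have [t0 ht0] : exists t0, (t0 \in Q) && (x < t0).
  apply/existsP; rewrite -[[exists _, _]]negbK negb_exists; apply/negP => /forallP h.
  have : #|Q| <= below Q x.+1.
    apply: subset_leq_card; apply/subsetP => t tQ; rewrite inE tQ ltnS leqNgt.
    by have := h t; rewrite tQ.
  rewrite belowS (negPf xQ) addn0 -eTQ leqNgt => /negP; apply.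
  by have := hTQ x; have := below_le_card T x.+1; rewrite belowS xT; lia.
have [q /andP[qQ lt_xq] qmin] := @arg_minnP _ t0 (fun t => (t \in Q) && (x < t)) val ht0.
have hmin t : t \in Q -> x <= t -> q <= t.
  move=> tQ xt; apply: qmin; rewrite tQ ltn_neqAle xt andbT.
  by apply: contraNneq xQ => /val_inj ->.
have bS z := below_swap z xQ qQ.
exists (swap x q Q); split.
- apply/sleP; rewrite card_swap //; split=> // z; have := bS z; have := hTQ z.
  have [le_zx|lt_xz] := leqP z x; first by lia.
  have [lt_qz|le_zq] := ltnP q z; first by lia.
  have e : below Q x.+1 = below Q z.
    apply: (@below_gap Q x) => // t tQ ht; rewrite leqNgt; apply/negP => /ltnW/(hmin t tQ) h.
    by have := leq_trans ht le_zq; rewrite ltnNge h.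
  move: e; rewrite belowS (negPf xQ) => e; have := hTQ x.
  have := below_mono T lt_xz; rewrite belowS xT; lia.
- by apply: swap_down => //; apply: ltnW.
- by rewrite mem_swap eqxx.
- by right; exists q.
Qed.

Lemma swap_mono q q' x P : q \in P -> x \notin P -> q' \notin P -> x <= q' ->
  sle (swap x q P) (swap q' q P).
Proof.
move=> qP xP q'P le; apply/sleP; rewrite !card_swap //; split=> // z.
by have := below_swap z xP qP; have := below_swap z q'P qP; lia.
Qed.

(** A run over a word from [P] to [Q] is an increasing sequence of sets, one for
    each letter, and its weight is the number of letters that belong to their
    set. Following the components of the sets gives disjoint nondecreasing
    subsequences, as in Greene's description of the shape of the tableau. *)
Definition set_step (x : 'I_n) (P Q : {set 'I_n}) (r : int) : Prop :=
  exists T, [/\ sle P T, sle T Q & r = (x \in T)%:Z%R].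

Lemma set_step_le x P Q v : set_step x P Q v -> sle P Q.
Proof. by move=> [T [h h' _]]; apply: sle_trans h h'. Qed.

Lemma set_step_diag x P v : set_step x P P v -> v = (x \in P)%:Z%R.
Proof. by move=> [T [h h' ->]]; rewrite (sle_anti (introT andP (conj h h'))). Qed.

Lemma run3 x y z P Q v : run set_step [:: x; y; z] P Q v <->
  exists T1 T2 T3, [/\ sle P T1, sle T1 T2, sle T2 T3, sle T3 Q &
    v = ((x \in T1) + (y \in T2) + (z \in T3))%:Z%R].
Proof.
split=> /=.
  move=> [P1 [r1 [s1 [[T1 [p1 q1 ->]] h2 ->]]]].
  move: h2 => [P2 [r2 [s2 [[T2 [p2 q2 ->]] h3 ->]]]].
  move: h3 => [P3 [r3 [s3 [[T3 [p3 q3 ->]] [<- ->] ->]]]].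
  exists T1, T2, T3; split=> //; [exact: sle_trans q1 p2|exact: sle_trans q2 p3|].
  by rewrite !PoszD addr0 addrA.
move=> [T1 [T2 [T3 [h1 h2 h3 h4 ->]]]].
exists T1, (x \in T1)%:Z%R, ((y \in T2) + (z \in T3))%:Z%R; split; last by rewrite !PoszD addrA.
  by exists T1; rewrite sle_refl.
exists T2, (y \in T2)%:Z%R, (z \in T3)%:Z%R; split; last by rewrite PoszD.
  by exists T2; rewrite sle_refl.
exists Q, (z \in T3)%:Z%R, 0%R; split; rewrite ?addr0 //.
by exists T3; split=> //; apply: sle_trans h2 h3.
Qed.

Local Ltac count_hits :=
  rewrite lez_nat;
  repeat match goal with
  | H : is_true (?x \in ?A) |- context [nat_of_bool (?x \in ?A)] => rewrite H
  | H : is_true (?x \notin ?A) |- context [nat_of_bool (?x \in ?A)] =>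
      rewrite (negPf H)
  end;
  repeat match goal with
  | |- context [nat_of_bool (?x \in ?A)] => case: (x \in A)
  end.

(** The letters [a] and [c] change places. If they are not both counted, it is
    enough to repeat one of the three sets. Otherwise [raise_to] and [lower_to]
    produce one set that contains both [a] and [c]. When the exchange puts one
    of them in the place of the other, and [b] is not counted, [b] fits into
    this place as well and is counted instead. *)
Lemma knuth_dominated u v : @knuth n u v ->
  dominated set_step u v /\ dominated set_step v u.
Proof.
have R := sle_refl.
case=> a b c lt_ab lt_bc; split=> P Q v0 /run3[T1 [T2 [T3 [h1 h2 h3 h4 ->]]]].
- have [hc|hc] := boolP (c \in T2); last first.
    exists ((b \in T1) + (a \in T3) + (c \in T3))%:Z%R; first by count_hits.
    by apply/run3; exists T1, T3, T3; split=> //; apply: sle_trans h2 h3.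
  have [ha|ha] := boolP (a \in T3); last first.
    exists ((b \in T1) + (a \in T1) + (c \in T2))%:Z%R; first by count_hits.
    by apply/run3; exists T1, T1, T2; split=> //; apply: sle_trans h3 h4.
  have [T' [k1 k2 aT' e]] := raise_to h3 ha.
  have cT' : c \in T'.
    case: e => [->//|[q [_ _ lt_qa _ ->]]]; rewrite mem_swap hc andbT.
    by apply/orP; right; rewrite -val_eqE /= gtn_eqF //; lia.
  exists ((b \in T1) + (a \in T') + (c \in T'))%:Z%R; first by count_hits.
  by apply/run3; exists T1, T', T'; split=> //; [apply: sle_trans h2 k1|apply: sle_trans k2 h4].
- have [ha|ha] := boolP (a \in T2); last first.
    exists ((b \in T1) + (c \in T3) + (a \in T3))%:Z%R; first by count_hits.
    by apply/run3; exists T1, T3, T3; split=> //; apply: sle_trans h2 h3.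
  have [hc|hc] := boolP (c \in T3); last first.
    exists ((b \in T1) + (c \in T1) + (a \in T2))%:Z%R; first by count_hits.
    by apply/run3; exists T1, T1, T2; split=> //; apply: sle_trans h3 h4.
  have [hb|hb] := boolP (b \in T1).
    have [U [k1 k2 aU e]] := raise_to h2 ha.
    have bU : b \in U.
      case: e => [->//|[q [_ _ lt_qa _ ->]]]; rewrite mem_swap hb andbT.
      by apply/orP; right; rewrite -val_eqE /= gtn_eqF //; lia.
    have [T' [k3 k4 cT' e']] := raise_to (sle_trans k2 h3) hc.
    have aT' : a \in T'.
      case: e' => [->//|[q [_ _ _ hmax ->]]]; rewrite mem_swap aU andbT.
      apply/orP; right; rewrite -val_eqE /= ltn_eqF //.
      by apply: leq_trans lt_ab _; apply: hmax.
    exists ((b \in T1) + (c \in T') + (a \in T'))%:Z%R; first by count_hits.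
    apply/run3; exists T1, T', T'; split=> //; last exact: sle_trans k4 h4.
    exact: sle_trans k1 k3.
  have [T' [k1 k2 cT' e]] := raise_to h3 hc.
  have [aT'|aT'] := boolP (a \in T').
    exists ((b \in T1) + (c \in T') + (a \in T'))%:Z%R; first by count_hits.
    by apply/run3; exists T1, T', T'; split=> //; [apply: sle_trans h2 k1|apply: sle_trans k2 h4].
  case: e => [e|[q [qT2 cT2 lt_qc hmax e]]]; first by rewrite e ha in aT'.
  move: (aT'); rewrite e mem_swap negb_or ha andbT negbK => /andP[_ /eqP eq_aq].
  subst q.
  have bT2 : b \notin T2 by apply/negP => /hmax/(_ lt_bc); rewrite leqNgt lt_ab.
  pose U := swap b a T2.
  have bU : b \in U by rewrite mem_swap eqxx.
  have l1 : sle T2 U by apply: swap_up => //; apply: ltnW.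
  have l2 : sle U T3 by apply: sle_trans k2; rewrite e; apply: swap_mono.
  exists ((b \in U) + (c \in T3) + (a \in T3))%:Z%R; first by count_hits.
  by apply/run3; exists U, T3, T3; split=> //; apply: sle_trans l1; apply: sle_trans h2.
- have [hc|hc] := boolP (c \in T1); last first.
    exists ((a \in T2) + (c \in T2) + (b \in T3))%:Z%R; first by count_hits.
    by apply/run3; exists T2, T2, T3; split=> //; apply: sle_trans h1 h2.
  have [ha|ha] := boolP (a \in T2); last first.
    exists ((a \in T1) + (c \in T1) + (b \in T3))%:Z%R; first by count_hits.
    by apply/run3; exists T1, T1, T3; split=> //; apply: sle_trans h2 h3.
  have [T' [k1 k2 aT' e]] := raise_to h2 ha.
  have cT' : c \in T'.
    case: e => [->//|[q [_ _ lt_qa _ ->]]]; rewrite mem_swap hc andbT.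
    by apply/orP; right; rewrite -val_eqE /= gtn_eqF //; lia.
  exists ((a \in T') + (c \in T') + (b \in T3))%:Z%R; first by count_hits.
  by apply/run3; exists T', T', T3; split=> //; [apply: sle_trans h1 k1|apply: sle_trans k2 h3].
- have [ha|ha] := boolP (a \in T1); last first.
    exists ((c \in T2) + (a \in T2) + (b \in T3))%:Z%R; first by count_hits.
    by apply/run3; exists T2, T2, T3; split=> //; apply: sle_trans h1 h2.
  have [hc|hc] := boolP (c \in T2); last first.
    exists ((c \in T1) + (a \in T1) + (b \in T3))%:Z%R; first by count_hits.
    by apply/run3; exists T1, T1, T3; split=> //; apply: sle_trans h2 h3.
  have [hb|hb] := boolP (b \in T3).
    have [U [k1 k2 cU e]] := lower_to h3 hc.
    have bU : b \in U.
      case: e => [->//|[q [_ _ lt_cq _ ->]]]; rewrite mem_swap hb andbT.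
      by apply/orP; right; rewrite -val_eqE /= ltn_eqF //; lia.
    have [T' [k3 k4 aT' e']] := lower_to (sle_trans h2 k1) ha.
    have cT' : c \in T'.
      case: e' => [->//|[q [_ _ _ hmin ->]]]; rewrite mem_swap cU andbT.
      apply/orP; right; rewrite -val_eqE /= gtn_eqF //.
      by apply: leq_ltn_trans lt_bc; apply: hmin.
    exists ((c \in T') + (a \in T') + (b \in T3))%:Z%R; first by count_hits.
    apply/run3; exists T', T', T3; split=> //; first exact: sle_trans h1 k3.
    exact: sle_trans k4 k2.
  have [T' [k1 k2 aT' e]] := lower_to h2 ha.
  have [cT'|cT'] := boolP (c \in T').
    exists ((c \in T') + (a \in T') + (b \in T3))%:Z%R; first by count_hits.
    by apply/run3; exists T', T', T3; split=> //; [apply: sle_trans h1 k1|apply: sle_trans k2 h3].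
  case: e => [e|[q [qT2 aT2 lt_aq hmin e]]]; first by rewrite e hc in cT'.
  move: (cT'); rewrite e mem_swap negb_or hc andbT negbK => /andP[_ /eqP eq_cq].
  subst q.
  have bT2 : b \notin T2 by apply/negP => /hmin/(_ lt_ab); rewrite leqNgt lt_bc.
  pose U := swap b c T2.
  have bU : b \in U by rewrite mem_swap eqxx.
  have l1 : sle T1 U by apply: (sle_trans k1); rewrite e; apply: swap_mono.
  have l2 : sle U T2 by apply: swap_down => //; apply: ltnW.
  exists ((c \in T1) + (a \in T1) + (b \in U))%:Z%R; first by count_hits.
  by apply/run3; exists T1, T1, U; split=> //; apply: sle_trans l2 (sle_trans h3 h4).
Qed.

Lemma congruence_dominated u v : congruence (@knuth n) u v ->
  dominated set_step u v /\ dominated set_step v u.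
Proof.
elim=> {u v} [u v|u|u v _ []|u v w _ [h1 h2] _ [h3 h4]|u u' v v' _ [h1 h2] _ [h3 h4]] //.
- exact: knuth_dominated.
- by split; apply: dominated_refl.
- by split; [apply: dominated_trans h1 h3|apply: dominated_trans h4 h2].
- by split; apply: dominated_cat.
Qed.

End SetAutomaton.

(** * Faithfulness, by tableaux *)
Section NormalForm.
Variable n : nat.
Implicit Types (C P Q T U : {set 'I_n}) (Cs : seq {set 'I_n}) (x y : 'I_n) (w : seq 'I_n).

Local Notation "u ~~~ v" := (congruence (@knuth n) u v) (at level 70).
Local Notation srun := (run (@set_step n)).

Let gtr : rel 'I_n := fun x y => y < x.

(** A strictly decreasing word is determined by its set of letters, so the
    columns of a tableau are represented by sets. *)
Definition column C : seq 'I_n := [seq x <- rev (enum 'I_n) | x \in C].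
Definition column_word (Cs : seq {set 'I_n}) : seq 'I_n := flatten (map column Cs).

Lemma mem_column C x : (x \in column C) = (x \in C).
Proof. by rewrite mem_filter mem_rev mem_enum andbT. Qed.

Lemma gtr_trans : transitive gtr.
Proof. by move=> y x z h1 h2; apply: ltn_trans h2 h1. Qed.

Lemma column_sorted C : sorted gtr (column C).
Proof.
apply: sorted_filter gtr_trans _ _ _; rewrite rev_sorted.
have : sorted ltn (map val (enum 'I_n)) by rewrite val_enum_ord iota_ltn_sorted.
by rewrite sorted_map.
Qed.

Lemma column_eq C w : sorted gtr w -> w =i C -> w = column C.
Proof.
move=> sw mw; apply: (irr_sorted_eq gtr_trans) => //; first by move=> x; rewrite /gtr ltnn.
  exact: column_sorted.
by move=> x; rewrite mem_column mw.
Qed.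

Lemma column_split C y : y \in C ->
  column C = column [set t in C | y < t] ++ y :: column [set t in C | t < y].
Proof.
move=> yC; apply/esym/column_eq.
  rewrite (sorted_pairwise gtr_trans) pairwise_cat allrel_consr /=.
  rewrite -!(sorted_pairwise gtr_trans) !column_sorted /= andbT.
  apply/andP; split; [apply/andP; split|].
  - by apply/allP => s; rewrite mem_column inE => /andP[].
  - apply/allrelP => s t; rewrite !mem_column !inE => /andP[_ h1] /andP[_ h2].
    exact: ltn_trans h2 h1.
  - by apply/allP => s; rewrite mem_column inE => /andP[].
move=> t; rewrite mem_cat inE !mem_column !inE.
have [->|] := eqVneq t y; first by rewrite yC orbT.
by rewrite -val_eqE /=; case: (t \in C) => //=; case: ltngtP.
Qed.

Lemma congr_left p u v : u ~~~ v -> p ++ u ~~~ p ++ v.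
Proof. by move=> h; apply: congr_cat (congr_refl _ p) h. Qed.

Lemma congr_right u v w : u ~~~ v -> u ++ w ~~~ v ++ w.
Proof. by move=> h; apply: congr_cat h (congr_refl _ w). Qed.

(** Repeated use of the relation cab = acb. *)
Lemma move_right q x y w : sorted gtr (rcons q y) -> x <= y ->
  x :: q ++ y :: w ~~~ q ++ [:: x, y & w].
Proof.
elim: q => [|q1 q IH]; first by move=> _ _; apply: congr_refl.
move=> hs le_xy; have hs' : sorted gtr (rcons q y) by move: hs => /= /path_sorted.
apply: (congr_trans (v := q1 :: x :: q ++ y :: w)); last first.
  by apply: (congr_left [:: q1]); apply: IH.
have [b [r [er le_xb lt_bq]]] : exists b r,
    [/\ q ++ y :: w = b :: r, x <= b & b < q1].
  case: q hs {IH hs'} => [|q2 q] /=.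
    by move=> /andP[h _]; exists y, w.
  move=> /andP[h1 h2]; exists q2, (q ++ y :: w); split=> //.
  apply: leq_trans le_xy _.
  have /allP/(_ y) := order_path_min gtr_trans h2.
  by rewrite mem_rcons mem_head => /(_ isT) /ltnW.
rewrite cat_cons er; apply: (congr_right r (u := [:: x; q1; b]) (v := [:: q1; x; b])).
by apply/congr_sym/congr_rel/knuth_cab.
Qed.

(** Repeated use of the relation bca = bac. *)
Lemma move_past a p y w : path gtr a p -> a <= y ->
  [:: a, y & p ++ w] ~~~ a :: p ++ y :: w.
Proof.
elim: p a => [|p1 p IH] a; first by move=> _ _; apply: congr_refl.
move=> /= /andP[h1 h2] le_ay.
apply: (congr_trans (v := [:: a, p1, y & p ++ w])).
  apply: (congr_right (p ++ w) (u := [:: a; y; p1]) (v := [:: a; p1; y])).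
  by apply/congr_rel/knuth_bca.
apply: (congr_left [:: a]); apply: IH => //.
exact: leq_trans (ltnW h1) le_ay.
Qed.

(** One step of column insertion: [x] replaces the smallest element [y] of the
    column that is at least [x], and [y] goes on to the next column. *)
Lemma column_bump C x y : y \in C -> x <= y ->
  (forall t, t \in C -> x <= t -> y <= t) ->
  x :: column C ~~~ column (x |: C :\ y) ++ [:: y].
Proof.
move=> yC le_xy hmin; have eC := column_split yC.
have eC' : column (x |: C :\ y) =
    column [set t in C | y < t] ++ x :: column [set t in C | t < y].
  rewrite (@column_split _ x) ?setU11 //.
  congr (column _ ++ _ :: column _); apply/setP => t; rewrite !inE.
    have [->|ne] := eqVneq t x; first by rewrite ltnn [y < x]ltnNge le_xy !andbF.
    have [->|ne'] := eqVneq t y; first by rewrite ltnn !andbF.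
    have [tC|//] := boolP (t \in C); apply/idP/idP => /= h; last exact: leq_ltn_trans le_xy h.
    by rewrite ltn_neqAle hmin ?(ltnW h) // andbT eq_sym.
  have [->|ne] := eqVneq t x.
    rewrite ltnn andbF; apply/esym/negP => /andP[xC lt_xy].
    by have := hmin x xC (leqnn x); rewrite leqNgt lt_xy.
  have [->|ne'] := eqVneq t y; first by rewrite ltnn andbF [y < x]ltnNge le_xy andbF.
  have [tC|//] := boolP (t \in C); apply/idP/idP => /= h; first exact: leq_trans h le_xy.
  by rewrite ltnNge; apply/negP => h'; have := hmin t tC h'; rewrite leqNgt h.
have hs : sorted gtr (rcons (column [set t in C | y < t]) y).
  by have := column_sorted C; rewrite eC -cat_rcons => /cat_sorted2[].
have hs' : sorted gtr (x :: column [set t in C | t < y]).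
  by have := column_sorted (x |: C :\ y); rewrite eC' => /cat_sorted2[].
rewrite eC eC'; apply: congr_trans (move_right _ hs le_xy) _.
rewrite -catA; apply: congr_left.
by have := move_past [::] hs' le_xy; rewrite cats0.
Qed.

Lemma column_grow C x : (forall t, t \in C -> t < x) -> x :: column C = column (x |: C).
Proof.
move=> h; apply: column_eq; last by move=> t; rewrite !inE mem_column.
rewrite /= (path_sortedE gtr_trans) column_sorted andbT.
by apply/allP => t; rewrite mem_column => /h.
Qed.

Definition cols_head Cs : {set 'I_n} := head set0 Cs.

(** In terms of counting functions, the rows of a semistandard tableau with
    columns [Cs] are weakly increasing and its columns get shorter. *)
Fixpoint tableau Cs : Prop :=
  if Cs is C :: Cs' then
    (forall z, below (cols_head Cs') z <= below C z) /\ tableau Cs'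
  else True.

Lemma below_set0 z : below (set0 : {set 'I_n}) z = 0.
Proof. by apply/eqP; rewrite cards_eq0; apply/eqP/setP => t; rewrite !inE. Qed.

Lemma below_setU1 C x z : x \notin C -> below (x |: C) z = below C z + (x < z).
Proof.
move=> xC; rewrite /below; have [lt_xz|le_zx] := ltnP x z; last first.
  rewrite addn0; congr #|pred_of_set _|; apply/setP => t; rewrite !inE.
  by case: eqP => // ->; rewrite (negPf xC) ltnNge le_zx.
rewrite addn1 (cardsD1 x) !inE eqxx lt_xz add1n; congr (#|pred_of_set _|.+1).
apply/setP => t; rewrite !inE; have [->|//] := eqVneq t x.
by rewrite (negPf xC).
Qed.

(** Column insertion. The bounds on the new first column are what the preceding
    column needs in order to remain before it. They hold because no entry lies
    between the inserted letter and the one that it replaces. *)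
Lemma column_insert Cs x : tableau Cs -> exists Cs', [/\ tableau Cs',
  x :: column_word Cs ~~~ column_word Cs',
  forall z, z <= x -> below (cols_head Cs') z <= below (cols_head Cs) z &
  forall z, x < z -> below (cols_head Cs') z <=
    maxn (below (cols_head Cs) z) (below (cols_head Cs) x).+1].
Proof.
elim: Cs x => [|C Cs IH] x /=.
  move=> _; exists [:: [set x]]; split.
  - by split=> // z; rewrite below_set0.
  - rewrite /column_word /= cats0 -[[set x]]setU0 -column_grow => [|t]; last by rewrite inE.
    rewrite (_ : column set0 = [::]); first exact: congr_refl.
    by apply/esym/column_eq => // t; rewrite inE.
  - move=> z le_zx; rewrite /= -[[set x]]setU0 below_setU1 ?inE // below_set0.
    by rewrite ltnNge le_zx.
  - move=> z lt_xz; rewrite /= -[[set x]]setU0 below_setU1 ?inE // below_set0 lt_xz.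
    by rewrite leq_max orbT.
move=> [hC htab].
have [/existsP[t0 ht0]|] := boolP [exists t, (t \in C) && (x <= t)]; last first.
  rewrite negb_exists => /forallP h.
  have lt_x t : t \in C -> t < x by move=> tC; have := h t; rewrite tC ltnNge.
  have xC : x \notin C by apply/negP => /lt_x; rewrite ltnn.
  have b z := below_setU1 z xC.
  exists (x |: C :: Cs); split=> /=.
  - by split=> // z; rewrite b (leq_trans (hC z)) // leq_addr.
  - by rewrite /column_word /= -column_grow //; apply: congr_refl.
  - by move=> z le_zx; rewrite b ltnNge le_zx addn0.
  - move=> z lt_xz; rewrite b lt_xz leq_max; apply/orP; right; rewrite addn1 ltnS.
    apply: subset_leq_card; apply/subsetP => t; rewrite !inE => /andP[tC _].
    by rewrite tC lt_x.
have [y /andP[yC le_xy] ymin] := @arg_minnP _ t0 (fun t => (t \in C) && (x <= t)) val ht0.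
have hmin t : t \in C -> x <= t -> y <= t by move=> h1 h2; apply: ymin; rewrite h1 h2.
have [Cs' [htab' hcong hlow hhigh]] := IH y htab.
have b z : below (x |: C :\ y) z + (y < z) = below C z + (x < z).
  have [e|ne] := eqVneq x y; first by rewrite e setD1K.
  have xC : x \notin C.
    by apply/negP => /hmin/(_ (leqnn x)) le_yx; case/eqP: ne; apply/val_inj/eqP; rewrite eqn_leq le_xy.
  exact: below_swap.
have flat z : x < z -> z <= y -> below C z = below C x.
  move=> lt_xz le_zy; congr #|pred_of_set _|; apply/setP => t; rewrite !inE.
  have [tC|//] := boolP (t \in C); rewrite /=; apply/idP/idP => h; last exact: ltn_trans h lt_xz.
  rewrite ltnNge; apply/negP => /(hmin t tC) h'.
  by have := leq_trans h le_zy; rewrite ltnNge h'.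
exists (x |: C :\ y :: Cs'); split=> /=.
- split=> // z; have := b z; have := hC z; have [le_zy|lt_yz] := leqP z y.
    by have := hlow z le_zy; lia.
  have := hhigh z lt_yz; rewrite (leq_ltn_trans le_xy lt_yz).
  have := hC y; have := belowS C y; rewrite yC; have := below_mono C lt_yz; lia.
- rewrite /column_word /= -!/(column_word _).
  apply: congr_trans (congr_right _ (column_bump yC le_xy hmin)) _.
  by rewrite -catA; apply: congr_left.
- by move=> z le_zx; have := b z; rewrite ltnNge (leq_trans le_zx le_xy) ltnNge le_zx; lia.
- move=> z lt_xz; have := b z; rewrite lt_xz; have [le_zy|lt_yz] := leqP z y.
    by rewrite (flat z) //; lia.
  by lia.
Qed.

Lemma tableau_exists w : exists2 Cs, tableau Cs & w ~~~ column_word Cs.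
Proof.
elim: w => [|x w [Cs htab h]]; first by exists [::] => //; apply: congr_refl.
have [Cs' [htab' h' _ _]] := column_insert x htab.
by exists Cs' => //; apply: congr_trans (congr_left [:: x] h) h'.
Qed.

(** The number of entries below [i] in the first [j] rows of the tableau. *)
Definition profile (j i : nat) Cs : nat := \sum_(C <- Cs) minn j (below C i).

(** Each of the increasing components of the states meets a decreasing word at
    most once. *)
Lemma srun_decreasing w P Q v z : sorted gtr w -> all (fun x : 'I_n => x < z) w ->
  srun w P Q v -> (v <= (below P z)%:Z)%R.
Proof.
elim: w P v z => [|x w IH] P v z; first by move=> _ _ [_ ->].
rewrite /= (path_sortedE gtr_trans) => /andP[lt_w sw] /andP[lt_xz _].
move=> [P1 [r [s [[T [leT leP1 ->]] h ->]]]].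
have := IH _ _ x sw lt_w h.
have := sle_below x leP1; have := belowS T x.
have := below_mono T lt_xz; have := sle_below z leT.
by case: (x \in T); lia.
Qed.

(** If the last state lies below [i], so do all the others. *)
Lemma srun_count w P Q v i : #|P| = below Q i -> srun w P Q v ->
  (v <= (count (fun x : 'I_n => (x < i)%N) w)%:Z)%R.
Proof.
elim: w P v => [|x w IH] P v e; first by move=> [_ ->].
move=> /= [P1 [r [s [[T [leT leP1 ->]] h ->]]]].
have eP1 : #|P1| = below Q i by rewrite -e (sle_card leT) (sle_card leP1).
have := IH _ _ eP1 h; rewrite PoszD => hs; apply: lerD hs; rewrite lez_nat.
case: (boolP (x \in T)) => // xT; rewrite lt0b.
have leQ : sle T Q by apply: sle_trans leP1 (run_le (@sle_refl n) (@sle_trans n) (@set_step_le n) h).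
have : #|T| <= below T i.
  by rewrite -(sle_card leT) e; apply: sle_below.
rewrite leqNgt => /negP h'; rewrite ltnNge; apply/negP => le_ix; apply: h'.
apply: proper_card; apply/properP; split; first by apply/subsetP => t; rewrite inE => /andP[].
by exists x => //; rewrite inE xT ltnNge le_ix.
Qed.

Lemma count_column C (p : pred 'I_n) : count p (column C) = #|[set t in C | p t]|.
Proof.
rewrite count_filter count_rev -sum1_count big_enum_cond -sum1_card.
by apply: eq_bigl => t; rewrite /= !inE andbC.
Qed.

Lemma srun_column C P Q v i j : #|P| = j -> below Q i = j ->
  srun (column C) P Q v -> (v <= (minn j (below C i))%:Z)%R.
Proof.
move=> eP eQ h; have h1 := srun_count (etrans eP (esym eQ)) h.
have h2 : (v <= (below P n)%:Z)%R.
  apply: srun_decreasing h; first exact: column_sorted.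
  by apply/allP => x _; apply: ltn_ord.
rewrite count_column -/(below C i) in h1; rewrite below_card // eP in h2.
by rewrite /minn; case: ifP.
Qed.

Lemma profile_upper Cs P Q v i j : #|P| = j -> below Q i = j ->
  srun (column_word Cs) P Q v -> (v <= (profile j i Cs)%:Z)%R.
Proof.
rewrite /profile => eP eQ; elim: Cs P v eP => [|C Cs IH] P v eP.
  by move=> [_ ->]; rewrite big_nil.
rewrite big_cons /column_word /= => /run_cat[T [r [s [h1 h2 ->]]]].
have leT := run_le (@sle_refl n) (@sle_trans n) (@set_step_le n).
have eT : #|T| = j by rewrite -(sle_card (leT _ _ _ _ h1)).
have := IH _ _ eT h2; rewrite PoszD; apply: lerD.
apply: srun_column eP _ h1; apply/eqP; rewrite eqn_leq; apply/andP; split.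
  by rewrite -eT below_le_card.
by rewrite -[X in X <= _]eQ; apply: sle_below (leT _ _ _ _ h2).
Qed.

(** The counting function of the set formed by the [j] smallest elements of [C]
    below [i], completed by the largest possible ones if [C] has fewer. *)
Definition best_level (j i : nat) C (z : nat) : nat :=
  maxn (minn j (below C z)) (j - (i - z)).
Definition best_set (j i : nat) C : {set 'I_n} :=
  [set z : 'I_n | (z < i) && (best_level j i C z < best_level j i C z.+1)].

Lemma below_step C z : below C z <= below C z.+1 <= (below C z).+1.
Proof.
rewrite below_mono //=; have [lt_zn|le_nz] := ltnP z n.
  by have := belowS C (Ordinal lt_zn); case: (_ \in C) => /= ->; lia.
by rewrite !below_card //; lia.
Qed.

Lemma below_best j i C z : j <= i -> i <= n -> z <= i ->
  below (best_set j i C) z = best_level j i C z.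
Proof.
move=> le_ji le_in; elim: z => [|z IH] lt_zi.
  by rewrite /best_level !below0; lia.
have lt_zn : z < n by apply: leq_trans lt_zi le_in.
have /= -> := belowS (best_set j i C) (Ordinal lt_zn); rewrite (IH (ltnW lt_zi)) inE /= lt_zi /=.
have := below_step C z; rewrite /best_level; case: ltnP; lia.
Qed.

Lemma below_best_ge j i C z : j <= i -> i <= n -> i <= z ->
  below (best_set j i C) z = j.
Proof.
move=> le_ji le_in le_iz; have := @below_best j i C i le_ji le_in (leqnn i).
have -> : best_level j i C i = j by rewrite /best_level; lia.
move=> {2}<-; congr #|pred_of_set _|; apply/setP => t; rewrite !inE.
case: (ltnP t i) => //= lt_ti; by rewrite (leq_trans lt_ti le_iz).
Qed.

Lemma card_best j i C : j <= i -> i <= n -> #|best_set j i C| = j.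
Proof. by move=> h1 h2; rewrite -(@below_card _ _ n) // below_best_ge. Qed.

Lemma best_mono j i C C' : j <= i -> i <= n ->
  (forall z, below C' z <= below C z) -> sle (best_set j i C) (best_set j i C').
Proof.
move=> h1 h2 h; apply/sleP; rewrite !card_best //; split=> // z.
have [le_zi|lt_iz] := leqP z i; last by rewrite !below_best_ge // ltnW.
by rewrite !below_best // /best_level; have := h z; lia.
Qed.

Lemma best_hits j i C : j <= i -> i <= n ->
  minn j (below C i) <= #|C :&: best_set j i C|.
Proof.
move=> h1 h2.
suff aux z : z <= i -> minn j (below C z) <= below (C :&: best_set j i C) z.
  by apply: leq_trans (aux i (leqnn i)) (below_le_card _ _).
elim: z => [|z IH] lt_zi; first by rewrite !below0 minn0.
have lt_zn : z < n by apply: leq_trans lt_zi h2.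
have /= -> := belowS C (Ordinal lt_zn); have /= -> := belowS (C :&: _) (Ordinal lt_zn).
have := IH (ltnW lt_zi); rewrite !inE /= lt_zi /=.
have /= := belowS C (Ordinal lt_zn).
case: (_ \in C) => /= e; last by lia.
by rewrite /best_level e; case: ltnP => /=; lia.
Qed.

Lemma srun_hold w P T : sle P T ->
  exists2 Q, sle P Q /\ sle Q T & srun w P Q (count (mem T) w)%:Z%R.
Proof.
elim: w P => [|x w IH] P le_PT; first by exists P => //; split; rewrite ?sle_refl.
have [Q [h1 h2] h] := IH T (sle_refl T).
exists Q; first by split=> //; apply: sle_trans h1.
by exists T, (x \in T)%:Z%R, (count (mem T) w)%:Z%R; split=> //; exists T; rewrite sle_refl.
Qed.

(** Hold the set [best_set j i C] while the column [C] is read. *)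
Lemma profile_lower Cs P j i : j <= i -> i <= n -> tableau Cs ->
  sle P (best_set j i (cols_head Cs)) ->
  exists Q v, [/\ below Q i = j, ((profile j i Cs)%:Z <= v)%R &
    srun (column_word Cs) P Q v].
Proof.
move=> h1 h2; rewrite /profile; elim: Cs P => [|C Cs IH] P.
  move=> _ /= leP; exists P, 0%R; split=> //; last by rewrite big_nil.
  apply/eqP; rewrite eqn_leq; apply/andP; split.
    by rewrite -(card_best set0 h1 h2) -(sle_card leP) below_le_card.
  by rewrite -[X in X <= _](below_best_ge (cols_head [::]) h1 h2 (leqnn i)) (sle_below i leP).
move=> /= [hC htab] leP; have [Q1 [k1 k2] hr1] := srun_hold (column C) leP.
have [|Q [v [eQ hv hr]]] := IH Q1 htab; first exact: sle_trans k2 (best_mono h1 h2 hC).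
exists Q, ((count (mem (best_set j i C)) (column C))%:Z + v)%R; split=> //; last exact: run_catI hr1 hr.
rewrite big_cons PoszD; apply: lerD hv; rewrite lez_nat count_column.
apply: leq_trans (best_hits _ h1 h2) _; apply: subset_leq_card.
by apply/subsetP => t; rewrite !inE.
Qed.

Lemma profile_step j i Cs : profile j.+1 i Cs =
  profile j i Cs + count (fun C => j < below C i) Cs.
Proof.
rewrite /profile; elim: Cs => [|C Cs IH]; first by rewrite !big_nil.
by rewrite !big_cons IH /=; case: ltnP; lia.
Qed.

Lemma tableau_nth j i Cs c : tableau Cs ->
  (j < below (nth set0 Cs c) i) = (c < count (fun C => j < below C i) Cs).
Proof.
elim: Cs c => [|C Cs IH] c /=; first by rewrite nth_nil below_set0.
move=> [h htab]; have [lt_j|le_j] := ltnP j (below C i).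
  by case: c => [|c] /=; rewrite ?lt_j ?IH.
have e : count (fun C => j < below C i) Cs = 0.
  apply/eqP; rewrite -leqn0 leqNgt -IH // -leqNgt.
  by apply: leq_trans le_j; case: Cs h {IH htab} => [|C' Cs] //=; rewrite below_set0.
case: c => [|c] /=; first by rewrite e; apply/negbTE; rewrite -leqNgt.
by rewrite IH // e.
Qed.

Lemma column_word_ext Cs Cs' : (forall c, nth set0 Cs c = nth set0 Cs' c) ->
  column_word Cs = column_word Cs'.
Proof.
have c0 : column set0 = [::] by apply/esym/column_eq => // t; rewrite inE.
have nil_case D : (forall c, nth set0 D c = set0) -> column_word D = [::].
  elim: D => //= C D IH h; have -> : C = set0 := h 0.
  by rewrite /column_word /= c0 -/(column_word D) IH // => c; apply: (h c.+1).
elim: Cs Cs' => [|C Cs IH] [|C' Cs'] h //.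
- by rewrite [RHS]nil_case // => c; rewrite -h nth_nil.
- by rewrite nil_case // => c; rewrite h nth_nil.
- have -> : C = C' := h 0.
  by rewrite /column_word /= -!/(column_word _) (IH Cs') // => c; apply: (h c.+1).
Qed.

Lemma below_le C z : below C z <= z.
Proof.
elim: z => [|z IH]; first by rewrite below0.
by have := below_step C z; lia.
Qed.

(** The differences of the profiles in [j] give the lengths of the rows of the
    tableau restricted to the letters below [i], and hence the heights of its
    columns. *)
Lemma tableau_profile_inj Cs Cs' : tableau Cs -> tableau Cs' ->
  (forall j i, j <= i -> i <= n -> profile j i Cs = profile j i Cs') ->
  column_word Cs = column_word Cs'.
Proof.
move=> h h' e; apply: column_word_ext => c; apply: below_inj => z.
wlog le_zn : z / z <= n.
  move=> H; have [/H//|lt_nz] := leqP z n.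
  by have := H n (leqnn n); rewrite !below_card // ltnW.
have e' j : profile j z Cs = profile j z Cs'.
  have [le_jz|lt_zj] := leqP j z; first exact: e.
    (* a column has at most [z] entries below [z] *)
  have clip D : profile j z D = profile z z D.
    by apply: eq_bigr => C _; have := below_le C z; lia.
  by rewrite !clip e.
have lt_eq j : (j < below (nth set0 Cs c) z) = (j < below (nth set0 Cs' c) z).
  rewrite !tableau_nth //; congr (c < _).
  by have := e' j.+1; rewrite !profile_step e' => /addnI.
apply/eqP; rewrite eqn_leq leqNgt lt_eq ltnn /=.
by rewrite leqNgt -lt_eq ltnn.
Qed.

(** The representation on sets is faithful: the profiles are maximal weights of
    runs, so equivalent words have the same tableau. *)
Theorem dominated_congruence u v :
  dominated (@set_step n) u v -> dominated (@set_step n) v u -> u ~~~ v.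
Proof.
move=> huv hvu; have [Cs h hu] := tableau_exists u; have [Cs' h' hv] := tableau_exists v.
have [du du'] := congruence_dominated hu; have [dv dv'] := congruence_dominated hv.
have half D D' j i : tableau D -> dominated (@set_step n) (column_word D) (column_word D') ->
    j <= i -> i <= n -> profile j i D <= profile j i D'.
  move=> hD hdom h1 h2.
  have [Q [r [eQ hr /hdom[r' hr' hrun]]]] :=
    profile_lower h1 h2 hD (sle_refl (best_set j i (cols_head D))).
  have := profile_upper (card_best _ h1 h2) eQ hrun; rewrite -lez_nat => hr2.
  exact: le_trans hr (le_trans hr' hr2).
suff e : column_word Cs = column_word Cs'.
  by apply: congr_trans hu _; rewrite e; apply: congr_sym.
apply: tableau_profile_inj => // j i h1 h2; apply/eqP; rewrite eqn_leq.
by apply/andP; split; apply: half => //;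
  [apply: dominated_trans du' (dominated_trans huv dv)
  |apply: dominated_trans dv' (dominated_trans hvu du)].
Qed.

End NormalForm.

(** * Integral relations along chains of sets *)
Section Relations.
Local Open Scope ring_scope.

Lemma weighted_shiftE om s d ds : weighted_shift om s d ds =
  \sum_(i < (size ds).+1) (om (s + i)%N)%:Z * nth 0 (d :: ds) i.
Proof.
elim: ds s d => [|d1 ds IH] s d /=; first by rewrite big_ord1 addn0 addr0.
rewrite big_ord_recl addn0 IH; congr (_ + _).
by apply: eq_bigr => i _; rewrite /= /bump /= addnA addn1.
Qed.

Lemma base_expansion_eq0 (B : nat) k (x : nat -> int) :
  (forall i, (absz (x i) < B)%N) -> \sum_(i < k) (B ^ i)%:Z * x i = 0 ->
  forall i, (i < k)%N -> x i = 0.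
Proof.
elim: k x => [//|k IH] x hx; rewrite big_ord_recl expn0 mul1r.
under eq_bigr do rewrite /= /bump /= add1n expnS PoszM -mulrA.
rewrite -mulr_sumr; set s := \sum_(i < k) _ => e.
have s0 : s = 0.
  have small (a b : int) : a + B%:Z * b = 0 -> (absz a < B)%N -> b = 0.
    by move=> {e} e lt_aB; have [||//] := ltrgtP b 0; nia.
  exact: small e (hx 0%N).
have x0 : x 0%N = 0 by move: e; rewrite s0 mulr0 addr0.
case=> [//|i] lt_ik; apply: (IH (fun i => x i.+1)) => //.
Qed.

Lemma weighted_shift_neq0 m D d ds i : (0 < i < m)%N ->
  size ds = m -> all (fun e => absz e <= D)%N (d :: ds) ->
  nth 0 (d :: ds) i != 0 -> weighted_shift (valley m D) 0 d ds != 0.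
Proof.
move=> hi sds hall; apply: contraNneq; rewrite weighted_shiftE.
pose x j := if (0 < j < m)%N then nth 0 (d :: ds) j else 0.
have -> : \sum_(j < (size ds).+1) (valley m D (0 + j)%N)%:Z * nth 0 (d :: ds) j =
    \sum_(j < (size ds).+1) (D.+1 ^ j)%:Z * x j.
  by apply: eq_bigr => j _; rewrite add0n /valley /x; case: ifP => _; rewrite ?mul0r ?mulr0.
move=> /base_expansion_eq0 => /(_ _ i).
rewrite /x hi => -> //; last by rewrite sds; case/andP: hi => _ /ltnW.
move=> j; rewrite /x; case: ifP => // hj; rewrite ltnS.
by apply: (allP hall); apply: mem_nth; rewrite /= sds ltnS; case/andP: hj => _ /ltnW.
Qed.

(** A vector of the kernel over the rationals, cleared of its denominators. *)
Lemma integral_dependence n (A : 'M[int]_(n.+1, n)) :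
  exists2 z : 'I_n.+1 -> int, exists i, z i != 0 &
    forall y, \sum_i z i * A i y = 0.
Proof.
pose M : 'M[rat]_(n.+1, n) := map_mx (fun a : int => a%:~R) A.
have ker0 : kermx M != 0.
  rewrite -mxrank_eq0 mxrank_ker subn_eq0 -ltnNge ltnS.
  exact: rank_leq_col.
pose v := nz_row (kermx M).
have v0 : v != 0 by rewrite nz_row_eq0.
have vM : v *m M = 0 by apply/sub_kermxP; apply: nz_row_sub.
pose z i := numq (v 0 i) * \prod_(k | k != i) denq (v 0 k).
pose q : int := \prod_k denq (v 0 k).
have zE i : (z i)%:~R = v 0 i * q%:~R :> rat.
  rewrite /z /q [in RHS](bigD1 i) //= rmorphM /= numqE [in RHS]rmorphM /=.
  by rewrite !mulrA.
have q0 : q != 0 by apply/prodf_neq0 => i _; apply: denq_neq0.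
exists z.
  have [i vi] : exists i, v 0 i != 0.
    apply/existsP; rewrite -negb_forall; apply: contraNN v0 => /forallP h.
    by apply/eqP/rowP => i; rewrite mxE; apply/eqP.
  by exists i; rewrite -(intr_eq0 rat) zE mulf_neq0 // intr_eq0.
move=> y; apply/eqP; rewrite -(intr_eq0 rat) rmorph_sum /=.
have /matrixP/(_ 0 y) := vM; rewrite !mxE => e.
apply/eqP; transitivity (q%:~R * \sum_j v 0 j * M j y); last by rewrite e mulr0.
rewrite mulr_sumr; apply: eq_bigr => i _.
by rewrite intrM zE !mxE mulrA [_ * q%:~R]mulrC.
Qed.

Variable n : nat.
Hypothesis n_gt0 : (0 < n)%N.
Local Notation sset := {set 'I_n}.
Local Notation lt := (slt (@sle n)).

Lemma slt_trans : transitive lt.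
Proof.
move=> Q P T /andP[h ne] /andP[h' _]; rewrite /slt (sle_trans h h') /=.
apply: contraNneq ne => e; subst T; apply/eqP/sle_anti.
by rewrite h h'.
Qed.

(** The indicator vectors of [n + 1] subsets of an [n]-element set are dependent.
    The sum of the coefficients vanishes because the sets of a chain have the
    same positive cardinality. A relation supported by the two ends of the chain
    would identify them, so some inner coefficient is nonzero. *)
Lemma chain_relation (R : sset) Rs : size Rs = n -> path lt R Rs ->
  exists ds : seq int, [/\ size ds = n.+1, \sum_(e <- ds) e = 0,
    forall y, \sum_(p <- zip (R :: Rs) ds) (y \in p.1)%:Z * p.2 = 0 &
    exists2 i, (0 < i < n)%N & nth 0 ds i != 0].
Proof.
move=> sRs hp; pose T i := nth set0 (R :: Rs) i.
have [z [i0 zi0] hz] := integral_dependence (\matrix_(i < n.+1, y < n) (y \in T i)%:Z).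
have {}hz y : \sum_(i < n.+1) (y \in T i)%:Z * z i = 0.
  by rewrite -[RHS](hz y); apply: eq_bigr => i _; rewrite mxE mulrC.
have hall := order_path_min slt_trans hp.
have lt_last : lt R (T n).
  have /allP := hall; apply; rewrite /T.
  have nth_pos p : (0 < p)%N -> nth set0 (R :: Rs) p = nth set0 Rs p.-1 by case: p.
  by rewrite nth_pos // mem_nth // sRs ltn_predL.
have cardT (i : 'I_n.+1) : #|T i| = #|R|.
  rewrite /T; case: i => -[//|i] /= lt_i.
  have hi : nth set0 Rs i \in Rs by apply: mem_nth; rewrite sRs.
  by move/allP: hall => /(_ _ hi)/andP[/sle_card].
have R_gt0 : (0 < #|R|)%N.
  case: posnP => // /eqP R0; move: lt_last => /andP[h /eqP[]].
  have := sle_card h; move: R0; rewrite cards_eq0 => /eqP ->.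
  by rewrite cards0 => /esym/eqP; rewrite cards_eq0 => /eqP ->.
have cardE (A : sset) : \sum_y (y \in A)%:Z = (#|A|)%:Z.
  rewrite -(big_morph Posz PoszD (erefl 0)) -sum1_card [in RHS]big_mkcond.
  by congr Posz; apply: eq_bigr => y _; case: (y \in A).
have sum0 : \sum_i z i = 0.
  have : \sum_(y : 'I_n) \sum_(i < n.+1) (y \in T i)%:Z * z i = 0 by apply: big1.
  rewrite exchange_big /=.
  under eq_bigr => i _ do rewrite -mulr_suml cardE cardT.
  rewrite -mulr_sumr => /eqP; rewrite mulf_eq0 => /orP[|/eqP//].
  by rewrite eqz_nat => /eqP e; rewrite e in R_gt0.
have [i /andP[hi zi]] : exists i : 'I_n.+1, (0 < i < n)%N && (z i != 0).
  apply/existsP; rewrite -[[exists _, _]]negbK negb_exists.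
  apply/negP => /forallP inner0'.
  have inner0 (j : 'I_n.+1) : j != ord0 -> j != ord_max -> z j = 0.
    rewrite -!(inj_eq val_inj) /= -lt0n => j0 jn; have := inner0' j.
    have -> : (0 < j < n)%N by rewrite j0 /= ltn_neqAle jn -ltnS ltn_ord.
    by rewrite negbK => /eqP.
  have ends (g : 'I_n.+1 -> int) :
      \sum_i g i * z i = g ord0 * z ord0 + g ord_max * z ord_max.
    have ne : ord_max != ord0 :> 'I_n.+1 by rewrite -val_eqE /= -lt0n.
    rewrite (bigD1 ord0) //= (bigD1 ord_max) //= big1 ?addr0 // => j /andP[j0 jn].
    by rewrite inner0 // mulr0.
  have ez : z ord_max = - z ord0.
    have := ends (fun _ => 1); under eq_bigr do rewrite mul1r.
    by rewrite sum0 !mul1r => /eqP; rewrite eq_sym addrC addr_eq0 => /eqP.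
  have z0 : z ord0 != 0.
    apply/eqP => z0; case/eqP: zi0.
    have [i0E|ne0] := eqVneq i0 ord0; first by rewrite i0E.
    have [i0E|ne1] := eqVneq i0 ord_max; first by rewrite i0E ez z0 oppr0.
    exact: inner0.
  move: lt_last => /andP[_ /eqP[]]; apply/setP => y.
  have := ends (fun i => (y \in T i)%:Z); rewrite hz ez mulrN -mulrBl => /esym/eqP.
  rewrite mulf_eq0 (negPf z0) orbF subr_eq0 eqz_nat /=.
  by rewrite [T 0%N]/T /=; case: (y \in R); case: (y \in T n).
exists (mkseq (fun i => z (inord i)) n.+1); split; first by rewrite size_mkseq.
- rewrite (big_nth 0) big_mkord size_mkseq -[RHS]sum0; apply: eq_bigr => j _.
  by rewrite nth_mkseq // inord_val.
- move=> y; rewrite (big_nth (set0, 0)) big_mkord size_zip size_mkseq.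
  have sR : size (R :: Rs) = n.+1 by rewrite /= sRs.
  rewrite sR minnn.
  rewrite -[RHS](hz y); apply: eq_bigr => j _.
  by rewrite nth_zip ?size_mkseq // nth_mkseq // inord_val.
- by exists i => //; rewrite nth_mkseq // inord_val.
Qed.

(** The chains are finitely many, so one bound serves for all of them. *)
Lemma chain_relation_bounded : exists2 D : nat, (0 < D)%N &
  forall (R : sset) Rs, size Rs = n -> path lt R Rs ->
  exists ds : seq int, [/\ size ds = n.+1, all (fun e => absz e <= D)%N ds,
    \sum_(e <- ds) e = 0,
    forall y, \sum_(p <- zip (R :: Rs) ds) (y \in p.1)%:Z * p.2 = 0 &
    exists2 i, (0 < i < n)%N & nth 0 ds i != 0].
Proof.
pose good (t : n.+1.-tuple sset) (ds : seq int) :=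
  path lt (thead t) (behead t) ->
  [/\ size ds = n.+1, \sum_(e <- ds) e = 0,
    forall y, \sum_(p <- zip t ds) (y \in p.1)%:Z * p.2 = 0 &
    exists2 i, (0 < i < n)%N & nth 0 ds i != 0].
have [f hf] : {f : n.+1.-tuple sset -> seq int & forall t, good t (f t)}.
  apply: choice => t; rewrite /good; case/tupleP: t => R Rs.
  rewrite theadE /=; have [hp|hp] := boolP (path lt R Rs); last by exists [::].
  by have [ds [h1 h2 h3 h4]] := chain_relation (size_tuple Rs) hp; exists ds.
pose D := (\max_t \max_(e <- f t) absz e)%N.
exists D.+1 => // R Rs sRs hp.
have st : size (R :: Rs) == n.+1 by rewrite /= sRs.
have /= := hf (Tuple st); rewrite /good => /(_ hp)[h1 h2 h3 h4].
exists (f (Tuple st)); split=> //; apply/allP => e he; apply: leqW.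
apply: leq_trans (leq_bigmax (Tuple st)).
by apply: (@leq_bigmax_seq _ _ xpredT (fun e : int => absz e)).
Qed.

End Relations.

Section PlacticRelations.
Local Open Scope ring_scope.
Variables (n : nat) (n_gt0 : (0 < n)%N).

Lemma weighted_shiftN om s d ds :
  weighted_shift om s (- d) (map -%R ds) = - weighted_shift om s d ds.
Proof.
elim: ds s d => [|d1 ds IH] s d /=; first by rewrite !addr0 mulrN.
by rewrite IH mulrN opprD.
Qed.

(** The weight of the loop at [P] over [W] is a sum of coordinates of the
    indicator vector of [P], so the same relations hold between loop weights;
    the sign is chosen so as to increase the cost. *)
Theorem plactic_relations : exists2 D : nat, (0 < D)%N &
  forall W : seq 'I_n,
    relations (@sle n) (fun P => \sum_(y <- W) (y \in P)%:Z) n D (valley n D).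
Proof.
have [D D_gt0 hD] := chain_relation_bounded n_gt0; exists D => // W R Rs sRs hp.
have [[|d ds] []] // := hD R Rs sRs hp; move=> [sds] hall sum0 rel0 [i hi zi].
have lin0 : lin (fun P : {set 'I_n} => \sum_(y <- W) (y \in P)%:Z) (R :: Rs) (d :: ds) = 0.
  rewrite /lin; under eq_bigr => p _ do rewrite -mulrzl mulrC mulr_suml.
  rewrite exchange_big /= big1 // => y _.
  by rewrite -[RHS](rel0 y); apply: eq_bigr => p _; rewrite intz.
have := weighted_shift_neq0 hi sds hall zi; rewrite neq_lt => /orP[neg|pos]; last first.
  by exists d, ds; split=> //; rewrite big_cons in sum0.
exists (- d), (map -%R ds); split.
- by rewrite size_map.
- rewrite /= abszN; move: hall => /= /andP[-> h]; rewrite all_map.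
  by apply: sub_all h => e /=; rewrite abszN.
- by move: sum0; rewrite big_cons big_map sumrN -opprD => ->; rewrite oppr0.
- move: lin0; rewrite /lin -map_cons.
  have -> : zip (R :: Rs) (map -%R (d :: ds)) = [seq (p.1, - p.2) | p <- zip (R :: Rs) (d :: ds)].
    by elim: (R :: Rs) (d :: ds) => [|r rs IH] [|e es] //=; rewrite IH.
  rewrite big_map => h; under eq_bigr do rewrite mulrNz.
  by rewrite sumrN h oppr0.
- by rewrite weighted_shiftN oppr_gt0.
Qed.

End PlacticRelations.

(** * Morphisms to the plactic and matrix semigroups *)
Section Lift.
Variables (S : semigroupType) (X : choiceType) (g : X -> S).
Local Open Scope group_scope.

Definition letter (x : X) : free_semigroup X := exist _ [:: x] isT.

Fixpoint free_lift_seq (x : X) (w : seq X) : S :=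
  if w is y :: w' then g x * free_lift_seq y w' else g x.

(** The universal property of the free semigroup. *)
Definition free_lift (u : free_semigroup X) : S :=
  match u with
  | exist (x :: w) _ => free_lift_seq x w
  | exist [::] nn => False_rect _ (elimN idP nn isT)
  end.

Lemma free_lift_mul : {morph free_lift : u v / u * v}.
Proof.
move=> [[|x u] // nu] [[|y v] // nv] /=.
by elim: u x {nu} => [|z u IH] x //=; rewrite IH mulgA.
Qed.

HB.instance Definition _ := isMultiplicative.Build _ _ free_lift free_lift_mul.
End Lift.

Lemma free_semigroup_ind (X : choiceType) (K : free_semigroup X -> Prop) :
  (forall x, K (letter x)) -> (forall x u, K u -> K (letter x * u)%g) ->
  forall u, K u.
Proof.
move=> h1 h2 [[|x w] // nw]; elim: w x nw => [|y w IH] x nw.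
  by have := h1 x; congr K; apply: val_inj.
have := h2 x _ (IH y isT); congr K; exact: val_inj.
Qed.

Section PlacticMorphisms.
Variables (n : nat) (X : choiceType).
Local Open Scope quotient_scope.

Definition plactic_class (w : seq 'I_n) : plactic n := \pi_(presented_monoid (@knuth n)) w.

Lemma plactic_classM u v : (plactic_class u * plactic_class v)%g = plactic_class (u ++ v).
Proof. exact: presented_mulE. Qed.

Lemma plactic_morphism (f : {multiplicative free_semigroup X -> plactic n}) u :
  f u = plactic_class (flatten [seq repr (f (letter x)) | x <- val u]).
Proof.
elim/free_semigroup_ind: u => [x|x u IH]; first by rewrite /= cats0 /plactic_class reprK.
by rewrite gmulfM IH /= -plactic_classM /plactic_class reprK.
Qed.

Lemma plactic_lift (g : X -> seq 'I_n) u :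
  free_lift (fun x => plactic_class (g x)) u = plactic_class (flatten (map g (val u))).
Proof.
elim/free_semigroup_ind: u => [x|x u IH]; first by rewrite /= cats0.
by rewrite free_lift_mul IH plactic_classM.
Qed.

Lemma plactic_classP u v : plactic_class u = plactic_class v <-> congruence (@knuth n) u v.
Proof. exact: presented_eqP. Qed.

End PlacticMorphisms.

Section TropicalRuns.
Local Open Scope ring_scope.
Variables (R : realType) (k : nat) (X : Type) (M : X -> 'M[tropical R]_k).

Definition word_matrix (w : seq X) : 'M[tropical R]_k :=
  foldr (fun x A => M x *m A) 1%:M w.

Lemma word_matrix_cat u v : word_matrix (u ++ v) = word_matrix u *m word_matrix v.
Proof. by elim: u => [|x u IH] /=; rewrite ?mul1mx // IH mulmxA. Qed.

Definition matrix_step (x : X) (i j : 'I_k) (r : R) : Prop := M x i j = Some r.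

Lemma trop_sum_Some (I : eqType) (s : seq I) (F : I -> tropical R) e :
  \sum_(i <- s) F i = Some e -> exists2 i, i \in s & F i = Some e.
Proof.
elim: s e => [|i s IH] e; first by rewrite big_nil.
rewrite big_cons /GRing.add /=; case eF: (F i) => [a|]; last first.
  by move=> /= /IH[j hj ej]; exists j; rewrite // inE hj orbT.
case es: (\sum_(j <- s) F j) => [b|] /= [<-]; last by exists i; rewrite ?mem_head.
case: leP => _; last by exists i; rewrite ?mem_head.
by have [j hj ej] := IH _ es; exists j; rewrite // inE hj orbT.
Qed.

Lemma trop_sum_ge (I : eqType) (s : seq I) (F : I -> tropical R) i r :
  i \in s -> F i = Some r -> exists2 e, \sum_(i <- s) F i = Some e & r <= e.
Proof.
elim: s => //= j s IH; rewrite inE => /orP[/eqP <-|hi] eF; rewrite big_cons /GRing.add /=.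
  rewrite eF; case: (\sum_(_ <- _) _) => [b|] /=; last by exists r.
  by exists (Num.max r b) => //; rewrite le_max lexx.
have [e -> le_re] := IH hi eF; case: (F j) => [a|] /=; last by exists e.
by exists (Num.max a e) => //; rewrite le_max le_re orbT.
Qed.

Lemma word_matrix_run w i j e :
  word_matrix w i j = Some e -> run matrix_step w i j e.
Proof.
elim: w i e => [|x w IH] i e /=.
  by rewrite mxE; case: eqP => [->|_] // [<-].
rewrite mxE => /trop_sum_Some[l _]; rewrite /GRing.mul /=.
case eM: (M x i l) => [a|] //; case eW: (word_matrix w l j) => [b|] //= [<-].
by exists l, a, b; split=> //; apply: IH.
Qed.

Lemma run_word_matrix w i j v : run matrix_step w i j v ->
  exists2 e, word_matrix w i j = Some e & v <= e.
Proof.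
elim: w i v => [|x w IH] i v /=.
  by move=> [-> ->]; exists 0; rewrite ?mxE ?eqxx.
move=> [l [a [b [eM /IH[b' eW le_b] ->]]]].
have [|e he le_e] := @trop_sum_ge _ (index_enum 'I_k) (fun l => M x i l * word_matrix w l j) l (a + b') (mem_index_enum _).
  by rewrite eM eW.
by exists e; rewrite ?mxE //; apply: le_trans le_e; rewrite lerD2l.
Qed.

Lemma word_matrix_eq u v : dominated matrix_step u v -> dominated matrix_step v u ->
  word_matrix u = word_matrix v.
Proof.
move=> huv hvu; apply/matrixP => i j.
case eu: (word_matrix u i j) => [a|].
  have [b1 le1 /run_word_matrix[b eb le2]] := huv _ _ _ (word_matrix_run eu).
  have [c1 le3 /run_word_matrix[c]] := hvu _ _ _ (word_matrix_run eb).
  rewrite eu => -[<-] le4; rewrite eb; congr Some; apply/eqP; rewrite eq_le.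
  by rewrite (le_trans le1 le2) (le_trans le3 le4).
case ev: (word_matrix v i j) => [b|] //.
have [b1 _ /run_word_matrix[c]] := hvu _ _ _ (word_matrix_run ev).
by rewrite eu.
Qed.

End TropicalRuns.

Section UTMorphisms.
Local Open Scope ring_scope.
Variables (R : realType) (k : nat) (X : choiceType).

Lemma UT_morphism (f : {multiplicative free_semigroup X -> UT R k}) u :
  val (f u) = word_matrix (fun x => val (f (letter x))) (val u).
Proof.
elim/free_semigroup_ind: u => [x|x u IH]; first by rewrite /= mulmx1.
by rewrite gmulfM /= IH.
Qed.

End UTMorphisms.

(** * Separation of the varieties *)
Section IdentityWords.
Variables (m D L : nat) (m_gt0 : 0 < m).

Definition left_side : free_semigroup (option (nat * bool)) :=
  exist _ (left_word m D L) (left_word_nnil D L m_gt0).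
Definition right_side : free_semigroup (option (nat * bool)) :=
  exist _ (right_word m D L) (right_word_nnil D L m_gt0).

Lemma sides_neq : left_side != right_side.
Proof. by rewrite -(inj_eq val_inj) /=; apply: left_right_neq. Qed.

(** Strict chains in [k <= m] indices have at most [m] elements. *)
Theorem UT_satisfies (R : realType) k : 0 < D -> k <= m -> k <= L ->
  satisfies (UT R k) left_side right_side.
Proof.
move=> D_gt0 le_km le_kL f; apply: val_inj; rewrite !UT_morphism /=.
set M := fun x => val (f (letter x)).
have ut x i j r : matrix_step M x i j r -> i <= j.
  rewrite /matrix_step => e; rewrite leqNgt; apply/negP => lt_ji.
  have /forallP/(_ i)/forallP/(_ j) := valP (f (letter x)).
  by rewrite lt_ji /= -/(M x) e.
have diag x i r : matrix_step M x i i r -> r = odflt 0%R (M x i i).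
  by rewrite /matrix_step => ->.
have oR : reflexive (fun i j : 'I_k => i <= j) by move=> i; apply: leqnn.
have oA : antisymmetric (fun i j : 'I_k => i <= j).
  by move=> i j h; apply/val_inj/anti_leq.
have oT : transitive (fun i j : 'I_k => i <= j) by move=> j i l; apply: leq_trans.
have [||h1 h2] := @left_right_equiv m D L R 'I_k _ (matrix_step M) _ oR oA oT ut diag m_gt0 D_gt0.
- by rewrite card_ord.
- move=> i s ss hp; exfalso.
  have : uniq (i :: s).
    apply: (@sorted_uniq _ (fun i j : 'I_k => i < j)) => //; first by move=> ? ? ?; apply: ltn_trans.
      by move=> ?; rewrite ltnn.
    apply: sub_path hp => a b; rewrite /slt => /andP[le_ab ne].
    by rewrite ltn_neqAle le_ab andbT (inj_eq val_inj).
  move=> /card_uniqP e; have := max_card [in i :: s].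
  by rewrite e card_ord /= ss ltnNge le_km.
exact: word_matrix_eq.
Qed.

Theorem plactic_satisfies n : 0 < D -> #|{set 'I_n}| <= L ->
  (forall W : seq 'I_n, relations (@sle n)
     (fun P => \sum_(y <- W) (y \in P)%:Z)%R m D (valley m D)) ->
  satisfies (plactic n) left_side right_side.
Proof.
move=> D_gt0 le_nL hrel f; rewrite !plactic_morphism /=; apply/plactic_classP.
pose g x : seq 'I_n := repr (f (letter x)).
have set_run_le := run_le (@sle_refl n) (@sle_trans n) (@set_step_le n).
have set_run_diag x P v : run (@set_step n) (g x) P P v ->
    v = (\sum_(y <- g x) (y \in P)%:Z)%R.
  by move=> /(run_diagE (@sle_refl n) (@sle_anti n) (@sle_trans n) (@set_step_le n)
    (d := fun y (P : {set 'I_n}) => (y \in P)%:Z%R) (@set_step_diag n))[].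
have [||h1 h2] := @left_right_equiv m D L int {set 'I_n} (@sle n)
  (fun x => run (@set_step n) (g x)) (fun x P => \sum_(y <- g x) (y \in P)%:Z)%R
  (@sle_refl n) (@sle_anti n) (@sle_trans n) (fun x => set_run_le (g x)) set_run_diag
  m_gt0 D_gt0.
- exact: le_nL.
- move=> P Ps sP hp; have [d [ds [h1 h2 h3 h4 h5]]] := hrel (flatten (map g (block m true))) P Ps sP hp.
  exists d, ds; split=> //; rewrite -[RHS]h4 /lin; apply: eq_bigr => p _.
  by rewrite big_flatten big_map.
by apply: dominated_congruence => P Q v /run_flatten; [move=> /h1|move=> /h2];
  move=> [v' lev /run_flatten h']; exists v'.
Qed.

Section Fails.
Variable n : nat.
Hypothesis lt_mn : m < n.

Let letters := letter_word m (penalty m D L) (penalty m D L) (valley m D).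

Lemma letters_lt x : all (fun y => y < n) (letters x).
Proof.
by case: x => [[t []]|]; apply: sub_all (decreasing_lt _ _) => y; move=> /leq_trans; apply.
Qed.

Definition ord_chain_step (y i j : 'I_n) : nat -> Prop := chain_step y i j.

Definition ord_letters (x : option (nat * bool)) : seq 'I_n :=
  pmap insub (letters x).

Lemma val_ord_letters w :
  map val (flatten (map ord_letters w)) = flatten (map letters w).
Proof.
rewrite map_flatten -map_comp; congr flatten; apply: eq_map => x /=.
rewrite /ord_letters pmap_filter; last exact: insubK.
by apply/all_filterP; apply: sub_all (letters_lt x) => y h; rewrite insubT.
Qed.

Lemma ord_chain_run w (i j : 'I_n) v :
  run ord_chain_step w i j v <-> run chain_step (map val w) i j v.
Proof.
elim: w i v => [|y w IH] i v /=.
  by split=> [[-> ->]|[/val_inj-> ->]].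
split=> [[l [r [s [h /IH h' ->]]]]|[l [r [s [h h' ->]]]]]; first by exists l, r, s.
have lt_ln : l < n by apply: leq_ltn_trans (chain_run_le h') (ltn_ord j).
by exists (Ordinal lt_ln), r, s; split=> //; apply/IH.
Qed.

Let i0 : 'I_n := Ordinal (leq_ltn_trans (leq0n m) lt_mn).
Let im : 'I_n := Ordinal lt_mn.

Lemma ord_chain_separates :
  exists2 v, run ord_chain_step (flatten (map ord_letters (left_word m D L))) i0 im v &
    forall v', run ord_chain_step (flatten (map ord_letters (right_word m D L))) i0 im v' ->
      v' < v.
Proof.
have [v hl hr] := chain_separates D L m_gt0; exists v.
  by apply/ord_chain_run; rewrite val_ord_letters.
by move=> v' /ord_chain_run; rewrite val_ord_letters; apply: hr.
Qed.

Lemma below1 (i : 'I_n) z : below [set i] z = (i < z).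
Proof. by rewrite -[[set i]]setU0 below_setU1 ?inE // below_set0. Qed.

Lemma sle1 (i j : 'I_n) : sle [set i] [set j] = (i <= j).
Proof.
apply/sleP/idP => [[_ /(_ j.+1)]|le_ij]; rewrite ?cards1.
  by rewrite !below1 ltnSn ltnS lt0b.
by split=> // z; rewrite !below1; case: (ltnP j z) => // /(leq_ltn_trans le_ij) ->.
Qed.

(** The chain automaton is the part of the set automaton on the sets with one
    element. *)
Lemma set_of_chain w (i j : 'I_n) v :
  run ord_chain_step w i j v -> run (@set_step n) w [set i] [set j] v%:Z%R.
Proof.
elim: w i v => [|y w IH] i v /=; first by move=> [-> ->].
move=> [l [r [s [[le_il ->] /IH h ->]]]].
exists [set l], (i <= y <= l : nat)%:Z%R, s%:Z%R; split=> //.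
have [/andP[h1 h2]|h0] := boolP (i <= y <= l).
  by exists [set y]; rewrite !sle1 inE eqxx.
exists [set i]; rewrite !sle1 inE; split=> //; congr (nat_of_bool _)%:Z%R.
by apply/esym/negbTE; apply: contraNneq h0 => ->; rewrite leqnn le_il.
Qed.

Lemma chain_of_set w (i j : 'I_n) v : run (@set_step n) w [set i] [set j] v ->
  exists2 v' : nat, (v <= v'%:Z)%R & run ord_chain_step w i j v'.
Proof.
elim: w i v => [|y w IH] i v /=; first by move=> [/set1_inj-> ->]; exists 0.
move=> [P [r [s [[T [h1 h2 ->]] h ->]]]].
have single Q : sle [set i] Q -> exists l, Q = [set l].
  by move=> /sle_card e; apply/cards1P; rewrite -e cards1.
have [l el] := single _ (sle_trans h1 h2); have [t et] := single _ h1; subst P T.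
have [s' les h'] := IH _ _ h; rewrite !sle1 in h1 h2.
exists ((i <= y <= l) + s')%N; last first.
  by exists l, (i <= y <= l : nat), s'; split=> //; split=> //; apply: leq_trans h1 h2.
rewrite PoszD; apply: lerD les; rewrite inE lez_nat.
by case: eqP => // ->; rewrite h1 h2.
Qed.

(** The longest nondecreasing subsequence is a Knuth invariant, and it
    distinguishes the two sides. *)
Theorem plactic_fails : ~ satisfies (plactic n) left_side right_side.
Proof.
pose g x := plactic_class (ord_letters x).
move=> /(_ (free_lift g)); rewrite -[X in X = _]/(free_lift g _) -[X in _ = X]/(free_lift g _).
rewrite !plactic_lift => /plactic_classP/congruence_dominated[h _].
have [v hl hr] := ord_chain_separates.
have [w lew /chain_of_set[v' lev /hr]] := h _ _ _ (set_of_chain hl).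
by have := le_trans lew lev; rewrite lez_nat leqNgt => /negPf ->.
Qed.

Section UTFails.
Variable R : realType.
Local Open Scope ring_scope.

(** The chain automaton as a representation by triangular matrices. *)
Definition chain_matrix (y : 'I_n) : 'M[tropical R]_n :=
  \matrix_(i, j) if (i <= j)%N then Some ((i <= y <= j)%N : nat)%:R else None.

Lemma chain_matrix_run w (i j : 'I_n) v : run ord_chain_step w i j v ->
  run (matrix_step chain_matrix) w i j v%:R.
Proof.
elim: w i v => [|y w IH] i v /=; first by move=> [-> ->].
move=> [l [r [s [[le_il ->] /IH h ->]]]].
exists l, (i <= y <= l : nat)%N%:R, s%:R; split=> //; last by rewrite -natrD.
by rewrite /matrix_step mxE le_il.
Qed.

Lemma run_chain_matrix w (i j : 'I_n) r : run (matrix_step chain_matrix) w i j r ->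
  exists2 v : nat, r = v%:R & run ord_chain_step w i j v.
Proof.
elim: w i r => [|y w IH] i r /=; first by move=> [-> ->]; exists 0%N.
move=> [l [a [b [h /IH[s -> hs] ->]]]]; move: h; rewrite /matrix_step mxE.
case: ifP => // le_il [<-]; exists ((i <= y <= l) + s)%N; first by rewrite natrD.
by exists l, (i <= y <= l : nat)%N, s.
Qed.

Lemma word_matrix_upper w : upper_triangular (word_matrix chain_matrix w).
Proof.
apply/forallP => i; apply/forallP => j; apply/implyP => lt_ji.
case e: (word_matrix _ _ i j) => [a|] //.
have [v _ /ord_chain_run/chain_run_le] := run_chain_matrix (word_matrix_run e).
by rewrite leqNgt lt_ji.
Qed.

Definition chain_UT (x : option (nat * bool)) : UT R n :=
  exist _ (word_matrix chain_matrix (ord_letters x)) (word_matrix_upper _).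

Lemma chain_UT_lift u : val (free_lift chain_UT u) =
  word_matrix chain_matrix (flatten (map ord_letters (val u))).
Proof.
elim/free_semigroup_ind: u => [x|x u IH]; first by rewrite /= cats0.
by rewrite free_lift_mul /= IH word_matrix_cat.
Qed.

Theorem UT_fails : ~ satisfies (UT R n) left_side right_side.
Proof.
move=> /(_ (free_lift chain_UT)) /(congr1 val).
rewrite -[X in X = _]/(val (free_lift chain_UT _)) -[X in _ = X]/(val (free_lift chain_UT _)).
rewrite !chain_UT_lift /= => e.
have [v hl hr] := ord_chain_separates.
have [a ea le_va] := run_word_matrix (chain_matrix_run hl).
rewrite e in ea; have [v' ev' /hr] := run_chain_matrix (word_matrix_run ea).
by move: le_va; rewrite ev' ler_nat leqNgt => /negPf ->.
Qed.

End UTFails.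

End Fails.

End IdentityWords.

Theorem corollary4p5 (R : realType) (n k : nat) (hn : (0 < n)%N)
  (hk : (0 < k)%N) : same_variety (plactic n) (UT R k) -> k = n.
Proof.
move=> same.
have UT_in : in_variety (plactic n) (UT R k) by apply/same.
have plactic_in : in_variety (UT R k) (plactic n) by apply/same.
case: (ltngtP k n) => // [lt_kn|lt_nk].
- have m_gt0 : 0 < n.-1 by lia.
  have lt_mn : n.-1 < n by lia.
  case: (plactic_fails (D := 1) (L := k) (m_gt0 := m_gt0) lt_mn).
  apply: plactic_in (sides_neq _ _ _) _.
  by apply: UT_satisfies => //; lia.
- have [D D_gt0 hD] := plactic_relations hn.
  case: (UT_fails (D := D) (L := #|{set 'I_n}|) (m_gt0 := hn) lt_nk (R := R)).
  apply: UT_in (sides_neq _ _ _) _.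
  exact: plactic_satisfies.
Qed.
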